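(* There is an algorithm which, given a tree $T$ on $n$ vertices, computes the strong vertex span $\operatorname{svs}(T)$ in $\mathcal{O}(n)$ time.
   Context: A weak homomorphism $f:G\to H$ is a map $f:V(G)\to V(H)$ such that for every edge $uv\in E(G)$, either $f(u)f(v)\in E(H)$ or $f(u)=f(v)$; it is surjective if $f(V(G))=V(H)$. For weak homomorphisms $f,g:G\to H$, $m_G(f,g)=\min\{d_H(f(u),g(u))\mid u\in V(G)\}$. For a connected graph $H$, the strong vertex span is $\operatorname{svs}(H)=\max\{m_P(f,g)\mid P \text{ is a path and } f,g:P\to H \text{ are surjective weak homomorphisms}\}$. *)

(* Defs.v *)
From mathcomp Require Import all_boot.

Set Implicit Arguments.
Unset Strict Implicit.
Unset Printing Implicit Defensive.

(** ** Finite simple graphs *)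

Record sgraph := SGraph {
  svertex :> finType;
  sedge : rel svertex;
  sedge_sym : symmetric sedge;
  sedge_irrefl : irreflexive sedge }.

Definition connected_graph (G : sgraph) : Prop :=
  0 < #|G| /\ forall u v : G, connect (@sedge G) u v.

Definition acyclic (G : sgraph) : Prop :=
  forall p : seq G, ucycle (@sedge G) p -> size p < 3.

Definition is_tree (G : sgraph) : Prop := connected_graph G /\ acyclic G.

(** Least length of a walk from [u] to [v]; [#|G|] if there is none. *)
Definition gdist (G : sgraph) (u v : G) : nat :=
  find (fun k => [exists p : k.-tuple G,
                    path (@sedge G) u p && (last u p == v)])
       (iota 0 #|G|).

Definition path_rel (m : nat) : rel 'I_m :=
  fun i j => (i.+1 == j :> nat) || (j.+1 == i :> nat).

Lemma path_rel_sym m : symmetric (@path_rel m).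
Proof. by move=> i j; rewrite /path_rel orbC. Qed.

Lemma path_rel_irrefl m : irreflexive (@path_rel m).
Proof. by move=> i; rewrite /path_rel orbb; apply/negbTE; rewrite gtn_eqF. Qed.

Definition path_graph (m : nat) : sgraph :=
  SGraph (@path_rel_sym m) (@path_rel_irrefl m).

(** ** Weak homomorphisms and the strong vertex span *)

Definition weak_hom (G H : sgraph) (f : G -> H) : Prop :=
  forall u v : G, sedge u v -> sedge (f u) (f v) \/ f u = f v.

Definition surj_weak_hom (G H : sgraph) (f : G -> H) : Prop :=
  weak_hom f /\ forall y : H, exists x : G, f x = y.

(** Since [gdist] never exceeds [#|H|], the default value [#|H|] is
    irrelevant as soon as [G] has a vertex. *)
Definition min_dist (G H : sgraph) (f g : G -> H) : nat :=
  \big[minn/#|H|]_(u : G) gdist (f u) (g u).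

(** [k] is the maximum of [min_dist f g] over all nonempty paths [P] and all
    surjective weak homomorphisms [f, g : P -> H]. *)
Definition is_svs (H : sgraph) (k : nat) : Prop :=
  (exists (m : nat) (f g : path_graph m.+1 -> H),
     [/\ surj_weak_hom f, surj_weak_hom g & min_dist f g = k]) /\
  (forall (m : nat) (f g : path_graph m.+1 -> H),
     surj_weak_hom f -> surj_weak_hom g -> min_dist f g <= k).

(** ** A word RAM with structured control flow

    A program uses finitely many registers and a random-access memory, both
    holding natural numbers below a word bound [W].  Producing a value that is
    not below [W] blocks the execution, so that no terminating run can
    profit from long integers.  Every evaluated expression node, every
    assignment or store and every test takes one unit of time. *)

Inductive expr :=
  | Lit of nat
  | Reg of nat
  | Add of expr & expr
  | Sub of expr & expr    (* truncated at 0 *)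
  | Fetch of expr.

Inductive cmd :=
  | Skip
  | Assign of nat & expr
  | Store of expr & expr  (* address, then value *)
  | Seq of cmd & cmd
  | If of expr & cmd & cmd
  | While of expr & cmd.

Record state := State { regs : nat -> nat; mem : nat -> nat }.

Definition upd (f : nat -> nat) (a v : nat) : nat -> nat :=
  fun b => if b == a then v else f b.

Definition word (W v : nat) : option nat := if v < W then Some v else None.

Fixpoint eval (W : nat) (st : state) (e : expr) : option nat :=
  match e with
  | Lit k => word W k
  | Reg r => word W (regs st r)
  | Add e1 e2 =>
      obind (fun a => obind (fun b => word W (a + b)) (eval W st e2))
            (eval W st e1)
  | Sub e1 e2 =>
      obind (fun a => obind (fun b => word W (a - b)) (eval W st e2))
            (eval W st e1)
  | Fetch e1 => obind (fun a => word W (mem st a)) (eval W st e1)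
  end.

Fixpoint ecost (e : expr) : nat :=
  match e with
  | Lit _ | Reg _ => 1
  | Add e1 e2 | Sub e1 e2 => (ecost e1 + ecost e2).+1
  | Fetch e1 => (ecost e1).+1
  end.

(** [exec W st c t st']: started in [st], [c] terminates in [st'] after
    exactly [t] units of time.  In tests, nonzero means true. *)
Inductive exec (W : nat) : state -> cmd -> nat -> state -> Prop :=
  | ExecSkip st :
      exec W st Skip 1 st
  | ExecSet st r e v :
      eval W st e = Some v ->
      exec W st (Assign r e) (ecost e).+1 (State (upd (regs st) r v) (mem st))
  | ExecStore st e1 e2 a v :
      eval W st e1 = Some a -> eval W st e2 = Some v ->
      exec W st (Store e1 e2) (ecost e1 + ecost e2).+1
           (State (regs st) (upd (mem st) a v))
  | ExecSeq st st1 st2 c1 c2 t1 t2 :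
      exec W st c1 t1 st1 -> exec W st1 c2 t2 st2 ->
      exec W st (Seq c1 c2) (t1 + t2) st2
  | ExecIf st st1 e v c1 c2 t :
      eval W st e = Some v ->
      exec W st (if v != 0 then c1 else c2) t st1 ->
      exec W st (If e c1 c2) ((ecost e).+1 + t) st1
  | ExecWhileStop st e c :
      eval W st e = Some 0 ->
      exec W st (While e c) (ecost e).+1 st
  | ExecWhileStep st st1 st2 e v c t1 t2 :
      eval W st e = Some v -> v != 0 ->
      exec W st c t1 st1 -> exec W st1 (While e c) t2 st2 ->
      exec W st (While e c) ((ecost e).+1 + (t1 + t2)) st2.

(** ** Graphs as inputs *)

(** [s] lists every edge exactly once, in one of its two orientations. *)
Definition edge_list (G : sgraph) (s : seq (G * G)) : Prop :=
  forall u v : G, count_mem (u, v) s + count_mem (v, u) s = sedge u v :> nat.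

(** The number of vertices is in register 0, the end points of the [i]-th edge
    (as numbered by [num]) are in memory cells [2 * i] and [2 * i + 1], and
    everything else is 0. *)
Definition input_state (G : sgraph) (num : G -> 'I_#|G|) (s : seq (G * G)) :
  state :=
  State (upd (fun=> 0) 0 #|G|)
        (nth 0 (flatten [seq [:: val (num uv.1); val (num uv.2)] | uv <- s])).

(** The result of a run is the final content of register 0. *)
Definition output (st : state) : nat := regs st 0.

(* Main.v *)
(** Delete the leaves of the tree round by round until no vertex of degree at
    least 3 remains, and let h be the number of rounds.  For n >= 2 the strong
    vertex span is max(1, h), and it is 0 for n = 1.

    Lower bound: when the last round begins, some vertex z still has three
    neighbours, and three branches at z have depth at least h in the tree.  A
    player parked at depth h in one branch is at distance at least h from
    everything outside of it, and three branches suffice for the players to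
    exchange their roles.  One player following the other at distance 1 gives
    the bound 1.

    Upper bound: what remains is a path R, and every vertex is within distance h
    of its projection to R.  If the distance always exceeded max(1, h), then the
    order of the two projections along R could never change, since a player on R
    cannot share its projection with the other one; but each player visits both
    ends of R.

    A queue of leaves together with the degree and the sum of the remaining
    neighbours of each vertex carries out all rounds in linear time. *)
From mathcomp Require Import all_boot zify.
Require Import Defs.

Set Implicit Arguments.
Unset Strict Implicit.
Unset Printing Implicit Defensive.

(** * Distances and walks *)

Section Distance.
Variable G : sgraph.
Implicit Types (u v : G) (p : seq G).

Lemma gdist_le_card u v : gdist u v <= #|G|.
Proof. by rewrite -[X in _ <= X](size_iota 0) find_size. Qed.

Lemma gdist_le u p : path (@sedge G) u p -> gdist u (last u p) <= size p.
Proof.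
move=> pp; rewrite leqNgt; apply/negP => lt_p.
have sz : size p < #|G| by apply: leq_trans lt_p (gdist_le_card _ _).
have /negP := negbT (before_find 0 lt_p); apply.
rewrite nth_iota //; apply/existsP; exists (in_tuple p).
by rewrite /= pp eqxx.
Qed.

Lemma gdist_walk u v :
    gdist u v < #|G| ->
  exists2 p, path (@sedge G) u p /\ last u p = v & size p = gdist u v.
Proof.
move=> lt_n; have lt_n' := lt_n; move: lt_n'.
rewrite {1}/gdist -[X in _ < X](size_iota 0) -has_find => /(nth_find 0).
rewrite -[find _ _]/(gdist u v) nth_iota // add0n => /existsP[p /andP[pp /eqP lp]].
by exists p; rewrite ?size_tuple.
Qed.

Lemma gdist_refl u : gdist u u = 0.
Proof. by apply/eqP; rewrite -leqn0; exact: (@gdist_le u [::]). Qed.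

Lemma gdist_edge u v : sedge u v -> gdist u v <= 1.
Proof. by move=> uv; apply: (@gdist_le u [:: v]); rewrite /= uv. Qed.

Lemma gdist_gt0 u v : u != v -> 0 < gdist u v.
Proof.
move=> uv; rewrite lt0n; apply/eqP => d0.
have [|p [_ lp]] := @gdist_walk u v; first by rewrite d0; apply/card_gt0P; exists u.
by rewrite d0 => /size0nil p0; rewrite p0 /= in lp; rewrite lp eqxx in uv.
Qed.

Section Potential.
Variable f : G -> nat.
Hypothesis f_lip : forall x y, sedge x y -> f x <= (f y).+1.

Lemma potential_walk u p : path (@sedge G) u p -> f u <= f (last u p) + size p.
Proof.
elim: p u => [|v p IHp] u /=; first by rewrite addn0.
move=> /andP[/f_lip uv /IHp]; lia.
Qed.

(** A walk realising the distance lowers [f] by at most one per step. If [gdist] has its default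
    value [#|G|], a simple path, which has fewer edges than that, gives the bound. *)
Lemma potential_gdist u v : connect (@sedge G) u v -> f u <= f v + gdist u v.
Proof.
move=> /connectP[p0 pp0 ->]; have [p pp up _] := shortenP pp0.
have sz_p : size p < #|G| by have := max_card [in u :: p]; rewrite (card_uniqP up).
have [] := leqP #|G| (gdist u (last u p)); first by move=> ?;
  apply: leq_trans (potential_walk pp) _; rewrite leq_add2l;
  apply: ltnW (leq_trans sz_p _).
by move=> /gdist_walk[q [/potential_walk + <-] <-].
Qed.

End Potential.

End Distance.

Lemma leq_min_dist (G H : sgraph) (f g : G -> H) k :
  k <= #|H| -> (forall u, k <= gdist (f u) (g u)) -> k <= min_dist f g.
Proof.
move=> kH kd; rewrite /min_dist; elim/big_ind: _ => // x y.
by rewrite leq_min => -> ->.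
Qed.

Lemma min_dist_leq (G H : sgraph) (f g : G -> H) u :
  min_dist f g <= gdist (f u) (g u).
Proof.
rewrite /min_dist; have: u \in index_enum G by rewrite mem_index_enum.
elim: (index_enum G) => [|v r IHr] //; rewrite in_cons big_cons geq_min.
by case/predU1P => [->|/IHr ->]; rewrite ?leqnn ?orbT.
Qed.

(** The vertices are visited one after another, each from the end of the walk built so far; symmetry
    of [e] allows the way back. *)
Lemma covering_walk (S : finType) (e : rel S) (s0 : S) :
    symmetric e ->
  exists2 p, path e s0 p & forall s, connect e s0 s -> s \in s0 :: p.
Proof.
move=> esym.
suff /(_ (enum S))[p pp cov]: forall r : seq S, exists2 p, path e s0 p
    & forall s, s \in r -> connect e s0 s -> s \in s0 :: p.
  by exists p => // s; apply: cov; rewrite mem_enum.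
elim=> [|a r [p pp cov]]; first by exists [::].
have [c_a|nc_a] := boolP (connect e s0 a); last first.
  exists p => // s; rewrite in_cons => /predU1P[->|]; last exact: cov.
  by rewrite (negbTE nc_a).
have: connect e (last s0 p) a.
  apply: connect_trans c_a; rewrite (sym_connect_sym esym).
  by apply/connectP; exists p.
case/connectP=> q pq lq; exists (p ++ q); first by rewrite cat_path pp.
move=> s; rewrite in_cons => /predU1P[-> _|/cov h /h].
  by rewrite lq -last_cat mem_last.
by rewrite -cat_cons mem_cat => ->.
Qed.

(** * Configurations of two players *)

Definition weak_step (G : sgraph) (x y : G) := (x == y) || sedge x y.

Lemma weak_step_sym (G : sgraph) : symmetric (@weak_step G).
Proof. by move=> x y; rewrite /weak_step eq_sym sedge_sym. Qed.

Lemma weak_step_refl (G : sgraph) : reflexive (@weak_step G).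
Proof. by move=> x; rewrite /weak_step eqxx. Qed.

Lemma sedge_weak_step (G : sgraph) (x y : G) : sedge x y -> weak_step x y.
Proof. by rewrite /weak_step => ->; rewrite orbT. Qed.

(** A configuration is the pair of positions of two players. A walk in this relation is a pair of
    weak homomorphisms from a path that stay at distance at least [k]; testing the distance at both
    ends makes the relation symmetric. *)
Definition joint_step (G : sgraph) (k : nat) : rel (G * G) :=
  fun s t => [&& weak_step s.1 t.1, weak_step s.2 t.2,
                 k <= gdist s.1 s.2 & k <= gdist t.1 t.2].

Lemma joint_step_sym (G : sgraph) k : symmetric (@joint_step G k).
Proof.
move=> s t; rewrite /joint_step ![weak_step s.1 _]weak_step_sym.
by rewrite ![weak_step s.2 _]weak_step_sym [(k <= _) && _]andbC.
Qed.

Definition svs_at_least (G : sgraph) (k : nat) : Prop :=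
  exists (m : nat) (f g : path_graph m.+1 -> G),
    [/\ surj_weak_hom f, surj_weak_hom g & k <= min_dist f g].

Lemma weak_hom_path (G : sgraph) m (f : path_graph m.+1 -> G) :
    (forall i j : path_graph m.+1, i.+1 = j -> weak_step (f i) (f j)) ->
  weak_hom f.
Proof.
move=> fS i j /orP[]/eqP/fS /predU1P[->|]; [by right|by left|by right|].
by rewrite sedge_sym; left.
Qed.

(** The two coordinates of a walk through the whole component of [s0] are the required
    homomorphisms; the covering hypotheses make them surjective. *)
Lemma svs_at_least_connect (G : sgraph) k (s0 : G * G) :
    k <= gdist s0.1 s0.2 ->
    (forall y, exists2 s, connect (@joint_step G k) s0 s & s.1 = y) ->
    (forall y, exists2 s, connect (@joint_step G k) s0 s & s.2 = y) ->
  svs_at_least G k.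
Proof.
move=> ks0 cov1 cov2.
have [p pp cov] := covering_walk s0 (@joint_step_sym G k).
pose h (i : path_graph (size p).+1) := nth s0 (s0 :: p) i.
have hS (i j : path_graph (size p).+1) : i.+1 = j -> joint_step k (h i) (h j).
  move=> ij; have lt_i : i < size p by have := ltn_ord j; lia.
  by rewrite /h -ij; exact: (pathP s0 pp).
have h_mem s : connect (@joint_step G k) s0 s -> exists i, h i = s.
  move=> /cov sp; have lt_s : index s (s0 :: p) < (size p).+1 by move: sp;
    rewrite -index_mem.
  by exists (Ordinal lt_s); rewrite /h nth_index.
exists (size p), (fun i => (h i).1), (fun i => (h i).2); split.
- split; first by apply: weak_hom_path => i j /hS /and4P[].
  by move=> y; have [s /h_mem[i hi] sy] := cov1 y; exists i; rewrite hi.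
- split; first by apply: weak_hom_path => i j /hS /and4P[].
  by move=> y; have [s /h_mem[i hi] sy] := cov2 y; exists i; rewrite hi.
(* The initial configuration is not the target of a step, so its distance bound comes from [ks0]. *)
apply: leq_min_dist => [|[[|i] lt_i]]; first exact: leq_trans ks0 (gdist_le_card _ _).
  exact: ks0.
have lt_i' : i < (size p).+1 by lia.
by have /and4P[] := hS (Ordinal lt_i') (Ordinal lt_i) erefl.
Qed.

(** * Upper bound *)

Section UpperBound.
Variables (G : sgraph) (k last_pos : nat) (R : pred G) (pos : G -> nat).
Hypothesis k_gt0 : 0 < k.
Hypothesis pos_edge : forall x y, sedge x y ->
  pos x = pos y \/ [/\ R x, R y & (pos x).+1 = pos y \/ (pos y).+1 = pos x].
Hypothesis pos_inj : {in R &, injective pos}.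
Hypothesis near : forall r x, R r -> pos r = pos x ->
  gdist r x <= k /\ gdist x r <= k.
Hypothesis pos_le : forall x, pos x <= last_pos.
Hypothesis pos_first : exists2 r, R r & pos r = 0.
Hypothesis pos_last : exists2 r, R r & pos r = last_pos.

Let pos_step x y : weak_step x y ->
  pos x = pos y \/ [/\ R x, R y, sedge x y & (pos x).+1 = pos y \/ (pos y).+1 = pos x].
Proof.
case/predU1P => [->|xy]; first by left.
by case: (pos_edge xy) => [|[]]; [left|right].
Qed.

(* One player cannot move onto the spine level with the other one, and
   exchanging two adjacent spine vertices needs distance 1. *)
Lemma pos_order_step a b a' b' :
    weak_step a a' -> weak_step b b' -> k < gdist a b -> k < gdist a' b' ->
  [/\ pos a < pos b -> pos a' < pos b', pos b < pos a -> pos b' < pos a'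
    & pos a = pos b -> pos a' = pos b'].
Proof.
move=> /pos_step sa /pos_step sb dab dab'.
have Na1 : R a -> pos a <> pos b by move=> Ra /(near Ra)[]; lia.
have Nb1 : R b -> pos b <> pos a by move=> Rb /(near Rb)[]; lia.
have Na2 : R a' -> pos a' <> pos b' by move=> Ra /(near Ra)[]; lia.
have Nb2 : R b' -> pos b' <> pos a' by move=> Rb /(near Rb)[]; lia.
case: sa => [ea|[Ra Ra' eaa' sa]]; case: sb => [eb|[Rb Rb' ebb' sb]].
- by rewrite -ea -eb.
- by have := Nb1 Rb; have := Nb2 Rb'; split; lia.
- by have := Na1 Ra; have := Na2 Ra'; split; lia.
have ab' : pos a' <> pos b.
  by move=> /(pos_inj Ra' Rb) eab; subst a'; have := gdist_edge eaa'; lia.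
by have := Na1 Ra; have := Na2 Ra'; split; lia.
Qed.

(** When [f] is at the first end of the spine, [g] lies strictly after it, since equal positions
    would give distance at most [k]; when [f] is at the last end, [g] lies strictly before it. This
    contradicts an order of positions that never changes. *)
Lemma min_dist_spine m (f g : path_graph m.+1 -> G) :
  surj_weak_hom f -> surj_weak_hom g -> min_dist f g <= k.
Proof.
move=> [wf sf] [wg sg]; rewrite leqNgt; apply/negP => gt_k.
have far u : k < gdist (f u) (g u) by apply: leq_trans gt_k (min_dist_leq _ _ _).
have wstep (h : path_graph m.+1 -> G) i j : weak_hom h -> sedge i j -> weak_step (h i) (h j).
  by move=> wh /wh[|->]; [exact: sedge_weak_step|exact: weak_step_refl].
(* Used below with [c] being [<], [>] and equality, each preserved by [pos_order_step]. *)
have inv (c : nat -> nat -> Prop) :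
    (forall i j : path_graph m.+1, i.+1 = j -> c (pos (f i)) (pos (g i)) -> c (pos (f j)) (pos (g j))) ->
    c (pos (f ord0)) (pos (g ord0)) -> forall i, c (pos (f i)) (pos (g i)).
  move=> cS c0 [i]; elim: i => [|i IHi] lt_i.
    by rewrite (_ : Ordinal lt_i = ord0) //; exact: val_inj.
  have lt_i' : i < m.+1 by lia.
  exact: cS (IHi lt_i').
have step (i j : path_graph m.+1) : i.+1 = j :> nat -> weak_step (f i) (f j) /\ weak_step (g i) (g j).
  by move=> ij; split; apply: wstep => //; rewrite /sedge /= /path_rel ij eqxx.
have [r0 Rr0 pr0] := pos_first; have [r1 Rr1 pr1] := pos_last.
have [i0 fi0] := sf r0; have [i1 fi1] := sf r1.
have g0 : pos (f i0) < pos (g i0).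
  rewrite fi0 pr0 lt0n; apply/eqP => pg.
  by have := far i0; have := near Rr0 (etrans pr0 (esym pg)); rewrite fi0; lia.
have g1 : pos (g i1) < pos (f i1).
  rewrite fi1 ltn_neqAle pr1 pos_le andbT; apply/eqP => pg.
  by have := far i1; have := near Rr1 (etrans pr1 (esym pg)); rewrite fi1; lia.
have stepc (i j : path_graph m.+1) (ij : i.+1 = j :> nat) := pos_order_step
  (step i j ij).1 (step i j ij).2 (far i) (far j).
case: (ltngtP (pos (f ord0)) (pos (g ord0))) => c0.
- have lt_fg : forall i, pos (f i) < pos (g i).
    by apply: (inv (fun a b => a < b)) => // i j /stepc[].
  by have := lt_fg i1; lia.
- have lt_gf : forall i, pos (g i) < pos (f i).
    by apply: (inv (fun a b => b < a)) => // i j /stepc[].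
  by have := lt_gf i0; lia.
- have eq_fg : forall i, pos (f i) = pos (g i).
    by apply: (inv eq) => // i j /stepc[].
  by have := eq_fg i0; lia.
Qed.
End UpperBound.

Lemma gdist_sym (G : sgraph) (u v : G) : gdist u v = gdist v u.
Proof.
suff le_d (x y : G) : gdist y x <= gdist x y.
  by apply/eqP; rewrite eqn_leq !le_d.
move: x y => {}u {}v.
have [|/gdist_walk[p [pp <-] <-]] := leqP #|G| (gdist u v).
  exact: leq_trans (gdist_le_card _ _).
have lp : last (last u p) (rev (belast u p)) = u by case: (p) => //= w r;
  rewrite rev_cons last_rcons.
rewrite -{2}lp -(size_belast u p) -size_rev; apply: gdist_le.
by rewrite rev_path -(eq_path (@sedge_sym G)).
Qed.

(** * Acyclic graphs *)

Section NeighbourSum.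
Variable G : sgraph.
Implicit Types (R : {set G}) (F : G -> nat) (u v w : G).

(** Covers both arrays of the program: the constant 1 for [F] gives the degree, the vertex number
    gives the sum of the remaining neighbours. *)
Definition nsum R F u : nat := \sum_(w in R) sedge u w * F w.

Definition deg R u : nat := nsum R (fun=> 1) u.

Lemma degE R u : deg R u = #|[set w in R | sedge u w]|.
Proof.
rewrite /deg /nsum -sum1dep_card big_mkcondr /=.
by apply: eq_bigr => w _; case: sedge.
Qed.

Lemma nsumD1 R F u v : v \in R -> nsum R F u = sedge u v * F v + nsum (R :\ v) F u.
Proof. by move=> vR; rewrite /nsum (big_setD1 v). Qed.

(** This is how the program finds the neighbour of a leaf: the sum has a single term. *)
Lemma nsum_leaf R F u w : w \in R -> sedge u w -> deg R u = 1 -> nsum R F u = F w.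
Proof.
move=> wR uw; rewrite /deg !(nsumD1 _ _ wR) uw !mul1n => -[d0].
rewrite /nsum big1 ?addn0 // => t tR; move/eqP: d0.
by rewrite /nsum sum_nat_eq0 => /forall_inP/(_ t tR); case: sedge.
Qed.

Lemma leaf_uniq R u v w :
  v \in R -> w \in R -> sedge u v -> sedge u w -> deg R u = 1 -> v = w.
Proof.
move=> vR wR uv uw; rewrite degE => /eqP/cards1P[t Rt].
have vt : v \in [set t] by rewrite -Rt inE vR.
have wt : w \in [set t] by rewrite -Rt inE wR.
by rewrite (set1P vt) (set1P wt).
Qed.

Lemma deg_gt0P R u : reflect (exists2 w, w \in R & sedge u w) (0 < deg R u).
Proof.
rewrite degE; apply: (iffP card_gt0P) => -[w]; last by exists w; rewrite inE; apply/andP.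
by rewrite inE => /andP[]; exists w.
Qed.

End NeighbourSum.

Section Acyclic.
Variable G : sgraph.
Hypothesis acycG : acyclic G.
Local Notation e := (@sedge G).
Implicit Types (R : {set G}) (u v w x y z : G) (p : seq G).

(** [acyclic] tolerates the closed walk along one edge and back, so only paths with two or more
    edges cannot be closed. *)
Lemma path_closing x p : path e x p -> uniq (x :: p) -> e (last x p) x -> size p < 2.
Proof.
move=> pp up lx; rewrite -ltnS; apply: (@acycG (x :: p)).
by rewrite /ucycle up andbT /= rcons_path pp.
Qed.

(** The segment from [t] to the end of the path closes up through the edge, so it has a single edge
    and [t] is the last vertex but one. *)
Lemma path_chord x p t :
    path e x p -> uniq (x :: p) -> t \in x :: p -> e t (last x p) ->
  (index t (x :: p)).+1 = size p.
Proof.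
move=> pp up tp; case/splitPl: tp pp up => p1 p2 lp1.
rewrite last_cat cat_path lp1 => /andP[_ pp2] up tl.
have eq_p : x :: p1 ++ p2 = belast x p1 ++ t :: p2.
  by rewrite -cat_cons lastI lp1 cat_rcons.
move: up; rewrite eq_p cat_uniq => /and3P[_ /hasPn/(_ t) tNp1 up2].
have := path_closing pp2 up2; rewrite sedge_sym tl => /(_ isT).
rewrite index_cat ifN ?tNp1 ?mem_head //= eqxx addn0 size_belast.
case: p2 tl {pp2 up2 eq_p tNp1} => [|? []] //=; last by rewrite size_cat addn1.
by rewrite sedge_irrefl.
Qed.

(** Adjacency in [R] without [z]: its connected components are the branches at [z]. *)
Definition branch_rel R z : rel G :=
  fun x y => [&& sedge x y, x \in R, y \in R, x != z & y != z].

Lemma branch_rel_sym R z : symmetric (branch_rel R z).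
Proof.
by move=> x y; apply/and5P/and5P => -[h *]; split; rewrite // sedge_sym.
Qed.

(** A simple path between distinct neighbours of [z] that avoids [z] would close to a cycle through
    [z]. *)
Lemma branch_disjoint R z w w' :
  e z w -> e z w' -> connect (branch_rel R z) w w' -> w = w'.
Proof.
move=> zw zw' /connectP[p0 pp0 lp]; move: pp0 lp => /shortenP[p pp up _ lp].
have pe : path e w p by apply: sub_path pp => x y /and5P[].
have zp : z \notin p.
  apply/negP => zp; suff: all (predC1 z) p by move/allP/(_ z zp); rewrite /= eqxx.
  by elim: p w pp {up lp pe zw zp} => //= y p IHp w /andP[/and5P[_ _ _ _ ->]] /IHp.
have := @path_closing z (w :: p); rewrite /= zw pe -lp sedge_sym zw'.
rewrite inE negb_or zp; move: (up) => /= ->; rewrite !andbT.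
case: eqP => [zw0|_]; first by rewrite zw0 sedge_irrefl in zw.
by case: p lp {pp pe up zp} => //= a p _ /(_ isT isT isT).
Qed.

(** A simple path starting with [z], [w] is extended inside [R] as long as possible. All neighbours
    of its end then lie on it, and by [path_chord] only the predecessor qualifies. *)
Lemma leaf_in_branch R z w :
    z \in R -> w \in R -> e z w ->
  exists2 u, (u \in R) && (deg R u == 1) & connect (branch_rel R z) w u.
Proof.
move=> zR wR zw.
(* [n] bounds the number of further extensions, since a simple path has at most [#|G|] vertices. *)
suff main n p : path e w p -> uniq [:: z, w & p] -> all [in R] p ->
    #|G| <= n + size p ->
    exists2 u, (u \in R) && (deg R u == 1) & connect (branch_rel R z) w u.
  have zNw : z != w by apply: contraTneq zw => ->; rewrite sedge_irrefl.
  by apply: (main #|G| [::]); rewrite //= ?inE ?zNw ?addn0.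
elim: n p => [|n IHn] p pp up pR lt_n.
  have := max_card [in [:: z, w & p]]; rewrite (card_uniqP up) /=.
  by move=> h; have := leq_trans h lt_n; rewrite add0n ltnNge leqnSn.
have lR : last w p \in R by have := mem_last w p; rewrite inE => /predU1P[->|/(allP pR)].
have pz : path e z (w :: p) by rewrite /= zw.
(* The list has [size p + 2] entries, so index [size p] is the predecessor of the last one. *)
pose t0 := nth z [:: z, w & p] (size p).
have t0R : t0 \in R.
  have /(allP (_ : all [in R] [:: z, w & p])) : t0 \in [:: z, w & p] by apply: mem_nth => /=; lia.
  by apply; rewrite /= zR wR.
have lt0 : e (last w p) t0.
  by rewrite sedge_sym (last_nth z) /=; apply: (pathP z pz (size p)).
have [/existsP[t /and3P[tR lt tNp]]|none] :=
    boolP [exists t, [&& t \in R, e (last w p) t & t \notin [:: z, w & p]]].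
  apply: (IHn (rcons p t)).
  - by rewrite rcons_path pp.
  - by rewrite -!rcons_cons rcons_uniq tNp.
  - by rewrite all_rcons tR.
  - by rewrite size_rcons addnS.
exists (last w p).
  rewrite lR degE; apply/cards1P; exists t0; apply/setP => t; rewrite !inE.
  apply/andP/eqP => [[tR lt]|->]; last by [].
  have tp : t \in [:: z, w & p].
    by apply: contraNT none => tNp; apply/existsP; exists t; rewrite tR lt.
  have := path_chord pz up tp; rewrite sedge_sym => /(_ lt) /= -[it].
  by rewrite /t0 -it; move: (nth_index z tp) => /= ->.
apply/connectP; exists p => //.
have: all (fun y => (y \in R) && (y != z)) (w :: p).
  apply/allP => y yp; apply/andP; split; first by move: yp;
    rewrite inE => /predU1P[->|/(allP pR)].
  by move: up => /= /andP[+ _]; apply: contraNneq => <-.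
elim: p w pp {IHn up pR lt_n lR pz t0 t0R lt0 none wR zw} => //= y p IHp w.
move=> /andP[wy pp] /and3P[/andP[wR wz] /andP[yR yz] ap].
by rewrite /branch_rel wy wR yR wz yz /= IHp //= yR yz.
Qed.

(** Induction on [R]: some vertex has degree at most 1, and removing it lowers the sum by twice its
    degree. *)
Lemma sum_deg_le R : \sum_(u in R) deg R u <= 2 * #|R|.
Proof.
have [n] := ubnP #|R|; elim: n => // n IHn in R *; rewrite ltnS => le_n.
have [->|/set0Pn[a aR]] := eqVneq R set0; first by rewrite big_set0.
have [v vR dv] : exists2 v, v \in R & deg R v <= 1.
  have [|] := leqP (deg R a) 0; first by exists a => //; lia.
  case/deg_gt0P => w wR aw; have [u /andP[uR /eqP du] _] := leaf_in_branch aR wR aw.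
  by exists u; rewrite ?du.
have cR := cardsD1 v R; rewrite vR in cR.
have {}IHn : \sum_(u in R :\ v) deg (R :\ v) u <= 2 * #|R :\ v| by apply: IHn; lia.
rewrite (big_setD1 v) //= (eq_bigr (fun u => sedge u v + deg (R :\ v) u)); last first.
  by move=> u _; rewrite /deg (nsumD1 _ _ vR) muln1.
rewrite big_split /= (_ : \sum_(u in _) _ = deg (R :\ v) v); last first.
  by apply: eq_bigr => u _; rewrite muln1 sedge_sym.
have : deg R v = deg (R :\ v) v by rewrite /deg (nsumD1 _ _ vR) sedge_irrefl.
lia.
Qed.

End Acyclic.

(** * Lower bound *)

Section LowerBound.
Variables (G : sgraph) (k : nat) (z : G) (W : {set G}).
Variables (B : G -> pred G) (far : G -> G).
Hypothesis conG : forall x y : G, connect (@sedge G) x y.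
Hypothesis card_W : 2 < #|W|.
Hypothesis B_far : forall w, w \in W -> B w (far w).
Hypothesis B_disj : forall v w y, v \in W -> w \in W -> B v y -> B w y -> v = w.
Hypothesis B_root : forall w, w \in W -> ~~ B w z.
Hypothesis B_exit : forall w a b, w \in W -> sedge a b -> B w a -> ~~ B w b -> b = z.
Hypothesis B_dist : forall w y, w \in W -> ~~ B w y -> k <= gdist (far w) y.

Local Notation J := (@joint_step G k).

Let third v w : exists2 u, u \in W & (u != v) && (u != w).
Proof.
have /card_gt0P[u] : 0 < #|W :\ v :\ w|.
  have := cardsD1 v W; have := cardsD1 w (W :\ v).
  by case: (_ \in _); case: (_ \in _); lia.
by rewrite !inE => /and3P[uw uv uW]; exists u; rewrite ?uv.
Qed.

(** Follow a walk to [z], stopping at its first visit there. The branch can be entered only from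
    [z], so the walk stays outside of it. *)
Let roam w y : w \in W -> ~~ B w y ->
  connect J (far w, y) (far w, z) /\ connect J (y, far w) (z, far w).
Proof.
move=> wW; have /connectP[p pp lp] := conG y z.
elim: p y pp lp => [|y' p IHp] y /= => [_ -> //|/andP[yy' pp] lp Ny].
have [->//|yz] := eqVneq y z.
have Ny' : ~~ B w y'.
  apply/negP => By'; case/eqP: yz; apply: (B_exit wW) By' Ny.
  by rewrite sedge_sym.
have [IH1 IH2] := IHp _ pp lp Ny'.
have dy := B_dist wW Ny; have dy' := B_dist wW Ny'.
split; [apply: connect_trans IH1 | apply: connect_trans IH2]; apply: connect1.
  by rewrite /joint_step /= weak_step_refl (sedge_weak_step yy') dy dy'.
by rewrite /joint_step /= weak_step_refl (sedge_weak_step yy') ![gdist _ (far w)]gdist_sym dy dy'.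
Qed.

(* Parking one player deep in a branch lets the other one roam outside of it;
   with three branches the two players can exchange roles and branches. *)
Lemma svs_at_least_branches : svs_at_least G k.
Proof.
have Jsym := sym_connect_sym (@joint_step_sym G k).
have Nfar v w : v \in W -> w \in W -> v != w -> ~~ B v (far w).
  move=> vW wW; apply: contra => Bv; apply/eqP; apply: B_disj Bv (B_far wW) => //.
(* The configuration passes through [(far v, far w)]. *)
have swap v w : v \in W -> w \in W -> v != w -> connect J (far v, z) (z, far w).
  move=> vW wW vw; have [h _] := roam vW (Nfar v w vW wW vw).
  rewrite eq_sym in vw; have [_ h'] := roam wW (Nfar w v wW vW vw).
  by rewrite Jsym in h; exact: connect_trans h h'.
(* Two exchanges through a third branch [u]: the configuration [(z, far u)] is reached from both
   sides. *)
have same v w : v \in W -> w \in W -> connect J (far v, z) (far w, z).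
  move=> vW wW; have [u uW /andP[uv uw]] := third v w.
  rewrite eq_sym in uv; apply: connect_trans (swap _ _ vW uW uv) _.
  by rewrite Jsym; apply: swap => //; rewrite eq_sym.
have cross v w : v \in W -> w \in W -> connect J (far v, z) (z, far w).
  move=> vW wW; have [u uW /andP[uv uw]] := third v w.
  exact: connect_trans (same _ _ vW uW) (swap _ _ uW wW uw).
(* Branches are disjoint, so [y] lies in at most one of them. *)
have avoid y : exists2 w, w \in W & ~~ B w y.
  have /card_gt0P[v vW] : 0 < #|W| by lia.
  have [Bv|] := boolP (B v y); last by exists v.
  have [w wW /andP[wv _]] := third v v; exists w => //.
  by apply: contra wv => Bw; apply/eqP; exact: B_disj Bw Bv.
have /card_gt0P[w0 w0W] : 0 < #|W| by lia.
apply: (@svs_at_least_connect _ _ (far w0, z)) => [|y|y] /=.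
- exact: B_dist (B_root w0W).
- have [w wW Nwy] := avoid y; exists (y, far w) => //.
  have [_ h] := roam wW Nwy; rewrite Jsym in h.
  exact: connect_trans (cross _ _ w0W wW) h.
have [w wW Nwy] := avoid y; exists (far w, y) => //.
have [h _] := roam wW Nwy; rewrite Jsym in h.
exact: connect_trans (same _ _ w0W wW) h.
Qed.

End LowerBound.

(** The second player walks anywhere, and the first one steps onto the vertex just left, so the two
    always stand on adjacent vertices. *)
Lemma svs_at_least1 (G : sgraph) : connected_graph G -> 1 < #|G| -> svs_at_least G 1.
Proof.
move=> [_ conG] /card_gt1P[u [u' [_ _ uu']]].
have nbr (x : G) : exists y, sedge x y.
  have [y xy] : exists y, x != y.
    by have [<-|?] := eqVneq u x; [exists u'|exists u; rewrite eq_sym].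
  have /connectP[[|y' p] /=] := conG x y; first by move=> _ /eqP;
    rewrite eq_sym (negbTE xy).
  by case/andP; exists y'.
have follow (x y z : G) : sedge x y -> sedge y z -> joint_step 1 (x, y) (y, z).
  move=> xy yz; rewrite /joint_step /= !sedge_weak_step //.
  by rewrite !gdist_gt0 //; apply: contraTneq isT => eq; [move: yz|move: xy];
    rewrite eq sedge_irrefl.
have chase (a b y : G) : sedge a b ->
    exists2 x, sedge x y & connect (@joint_step G 1) (a, b) (x, y).
  have /connectP[p pp ->] := conG b y.
  elim: p a b pp => [|w p IHp] a b /=; first by exists a.
  case/andP=> bw pp ab; have [x xy cx] := IHp _ _ pp bw; exists x => //.
  by apply: connect_trans cx; apply/connect1/follow.
have [v uv] := nbr u; have reach y := chase u v y uv.
apply: (@svs_at_least_connect _ _ (u, v)) => [|y|y] /=.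
- by apply: gdist_gt0; apply: contraTneq uv => ->; rewrite sedge_irrefl.
(* One more step of the second player brings the first one to [y]. *)
- have [x xy cx] := reach y; have [w yw] := nbr y; exists (y, w) => //.
  by apply: connect_trans cx _; apply/connect1/follow.
by have [x _ cx] := reach y; exists (x, y).
Qed.

(** * Deleting leaves *)

Section Peeling.
Variable G : sgraph.
Implicit Types (R : {set G}) (pi : G -> G) (dl lev : G -> nat) (q : seq G) (c : nat).
Local Notation e := (@sedge G).

(* [pi] sends each deleted vertex to the vertex of [R] below which it hangs, at
   depth [dl]. *)
Record retraction R pi dl : Prop := Retraction {
  retr_in : forall x, pi x \in R;
  retr_id : forall x, x \in R -> pi x = x;
  retr_depth0 : forall x, x \in R -> dl x = 0;
  retr_edge : forall x y, sedge x y ->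
    pi x = pi y /\ dl x <= (dl y).+1 \/ x \in R /\ y \in R;
  retr_walk : forall x, exists2 p, path e x p /\ last x p = pi x & size p = dl x }.

(* [R] is what is left of the tree, the queue [q] holds the leaves of [R], [lev u]
   is the number of deletion rounds after which [u] became a leaf, and [c] is
   the number of rounds begun so far. *)
Record peeling R pi dl lev q c : Prop := Peeling {
  peel_retr : retraction R pi dl;
  peel_uniq : uniq q;
  peel_leaf : forall u, (u \in q) = (u \in R) && (deg R u == 1);
  peel_sorted : sorted leq (map lev q);
  peel_lev : forall u, u \in q -> c <= (lev u).+1 /\ lev u <= c;
  peel_depth : forall x, dl x <= c;
  peel_depth_leaf : forall x, pi x \in q -> dl x <= lev (pi x);
  peel_deep : forall u, u \in q -> exists2 x, pi x = u & lev u <= dl x }.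

Lemma peeling_init q :
    uniq q -> (forall u, (u \in q) = (deg [set: G] u == 1)) ->
  peeling setT id (fun=> 0) (fun=> 0) q 0.
Proof.
move=> uq q_leaf; split=> //.
- split=> [x|x|x|x y|x]; rewrite ?inE //; last by exists [::].
  by right.
- by move=> u; rewrite inE q_leaf.
- by rewrite (_ : map _ q = nseq (size q) 0);
    [elim: (size q) => // -[]|elim: q {uq q_leaf} => //= a q ->].
- by move=> u _; exists u.
Qed.

Hypothesis conG : forall x y : G, connect e x y.
Hypothesis acycG : acyclic G.

(** * Span bounds from a retraction to a subtree *)

Section Retraction.
Variables (R : {set G}) (pi : G -> G) (dl : G -> nat).
Hypothesis retr : retraction R pi dl.

(** [R] is connected: [pi] turns a walk of [G] into a walk of [R] with pauses. *)
Lemma retraction_closed (S : pred G) x :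
    x \in R -> S x -> (forall a b, a \in R -> b \in R -> S a -> sedge a b -> S b) ->
  {in R, forall y, S y}.
Proof.
move=> xR Sx Scl y yR; rewrite -(retr_id retr yR).
have /connectP[p pp ->] := conG x y; have: S (pi x) by rewrite (retr_id retr).
elim: p x pp {xR Sx} => //= a p IHp x /andP[xa pp] Sx; apply: IHp pp _.
case: (retr_edge retr xa) => [[<- _] //|[xR aR]].
by rewrite (retr_id retr aR); rewrite (retr_id retr xR) in Sx; exact: Scl Sx xa.
Qed.

Lemma gdist_retraction x : gdist x (pi x) <= dl x.
Proof. by have [p [pp <-] <-] := retr_walk retr x; exact: gdist_le. Qed.

(** The preimages under [pi] of the branches of [R] at [z] are the branches of the whole tree. Each
    contains a leaf of [R] and a vertex hanging below it at depth at least [k - 1], which is at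
    distance at least [k] from everything outside. *)
Lemma svs_at_least_retraction k z :
    z \in R -> 2 < deg R z ->
    (forall u, u \in R -> deg R u = 1 -> exists2 x, pi x = u & k <= (dl x).+1) ->
  svs_at_least G k.
Proof.
move=> zR dz deep.
pose W := [set w in R | sedge z w].
pose B w y := connect (branch_rel R z) w (pi y).
have inW w : w \in W -> [/\ w \in R, sedge z w & w != z].
  rewrite inE => /andP[-> zw]; split=> //.
  by apply: contraTneq zw => ->; rewrite sedge_irrefl.
have far_ex w : w \in W -> exists2 x, B w x & k <= (dl x).+1.
  case/inW => wR zw _; have [u /andP[uR /eqP du] wu] := leaf_in_branch acycG zR wR zw.
  by have [x px kx] := deep u uR du; exists x; rewrite // /B px.
pose far w := odflt z [pick x | B w x && (k <= (dl x).+1)].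
have farP w : w \in W -> B w (far w) /\ k <= (dl (far w)).+1.
  move=> /far_ex[x Bx kx]; rewrite /far; case: pickP => [y /andP[]//|/(_ x)].
  by rewrite Bx kx.
have B_neq w y : w \in W -> B w y -> pi y != z.
  case/inW => _ _ wz /connectP[p pp ->].
  elim: p w wz pp => //= a p IHp w _ /andP[/and5P[_ _ _ _ az]]; exact: IHp.
have Bz w : w \in W -> ~~ B w z.
  by move=> wW; apply/negP => /(B_neq _ _ wW); rewrite (retr_id retr zR) eqxx.
have exitB w a b : w \in W -> sedge a b -> B w a -> ~~ B w b -> b = z.
  move=> wW ab Ba; have az := B_neq _ _ wW Ba.
  case: (retr_edge retr ab) => [[eq_ab _]|[aR bR]];
    first by rewrite /B -eq_ab [connect _ _ _]Ba.
  move=> Nb; apply/eqP; apply: contraNT Nb => bz; apply: connect_trans Ba _.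
  rewrite (retr_id retr aR) in az *; rewrite (retr_id retr bR); apply: connect1.
  by rewrite /branch_rel ab aR bR az bz.
apply: (@svs_at_least_branches G k z W B far) => //.
- by rewrite /W -degE.
- by move=> w /farP[].
- move=> v w y vW wW Bv Bw; have [_ zv _] := inW _ vW; have [_ zw _] := inW _ wW.
  apply: (branch_disjoint acycG zv zw); apply: connect_trans Bv _.
  by rewrite (sym_connect_sym (@branch_rel_sym G R z)).
move=> w y wW Ny; have [Bf kf] := farP w wW.
(* The distance bound comes from this 1-Lipschitz function. *)
pose f x := if B w x then (dl x).+1 else 0.
have fy : f y = 0 by rewrite /f (negbTE Ny).
have ff : k <= f (far w) by rewrite /f Bf.
rewrite -[gdist _ _]add0n -fy; apply: leq_trans ff _; apply: potential_gdist => // a b ab.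
rewrite /f; case: ifP => // Ba; case: ifP => [Bb|/negbT Nb].
  case: (retr_edge retr ab) => [[_ //]|[aR bR]].
  by rewrite !(retr_depth0 retr).
case: (retr_edge retr ab) => [[eq_ab _]|[aR _]]; last by rewrite (retr_depth0 retr).
by rewrite /B -eq_ab [connect _ _ _]Ba in Nb.
Qed.

(* A longest simple path of [R] exhausts it, as no inner vertex can have a third
   neighbour. *)
Lemma spine : R != set0 -> {in R, forall z, deg R z <= 2} ->
  exists x p, [/\ path e x p, uniq (x :: p) & forall y, (y \in R) = (y \in x :: p)].
Proof.
case/set0Pn => x0 x0R deg2.
suff main n x p : path e x p -> uniq (x :: p) -> all [in R] (x :: p) ->
    #|G| <= n + size p ->
    exists x p, [/\ path e x p, uniq (x :: p) & forall y, (y \in R) = (y \in x :: p)].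
  by apply: (main #|G| x0 [::]); rewrite //= ?addn0 ?x0R.
elim: n x p => [|n IHn] x p pp up pR lt_n.
  have := max_card [in x :: p]; rewrite (card_uniqP up) /= => h.
  by have := leq_trans h lt_n; rewrite add0n ltnn.
have [/existsP[y /existsP[t /and4P[yp tR tNp yt]]]|none] :=
  boolP [exists y, exists t, [&& y \in x :: p, t \in R, t \notin x :: p & e y t]];
    last first.
  exists x, p; split=> // y; apply/idP/idP => [yR|]; last exact: (allP pR).
  have xR : x \in R by apply: (allP pR); exact: mem_head.
  apply: (@retraction_closed [in x :: p] x xR) yR; first exact: mem_head.
  move=> a b aR bR ap ab; apply: contraNT none => Nb.
  by apply/existsP; exists a; apply/existsP; exists b; rewrite ap bR Nb ab.
have [yl|yNl] := eqVneq y (last x p).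
  apply: (IHn x (rcons p t)).
  - by rewrite rcons_path pp -yl.
  - by rewrite -rcons_cons rcons_uniq tNp.
  - by rewrite -rcons_cons all_rcons tR.
  - by rewrite size_rcons addnS.
have [yx|yNx] := eqVneq y x.
  apply: (IHn t (x :: p)).
  - by rewrite /= sedge_sym -yx yt yx.
  - by rewrite cons_uniq tNp.
  - by rewrite [all _ _]/= tR.
  - by rewrite /= addnS.
pose i := index y (x :: p).
have i_gt0 : 0 < i by rewrite /i /= eq_sym (negbTE yNx).
have lt_i : i < size p.
  rewrite ltn_neqAle; have: i < (size p).+1 by move: yp; rewrite -index_mem.
  rewrite ltnS => ->; rewrite andbT; apply: contraNneq yNl => ei.
  by rewrite -(nth_index x yp) -/i ei -last_nth.
have ny : nth x (x :: p) i = y by exact: nth_index.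
pose a := nth x (x :: p) i.-1; pose b := nth x (x :: p) i.+1.
have lt_i1 : i.-1 < size p := leq_ltn_trans (leq_pred i) lt_i.
have ay : e y a.
  have := pathP x pp i.-1 lt_i1; rewrite -[nth x p _]/(nth x (x :: p) i.-1.+1) prednK //.
  by rewrite ny sedge_sym.
have yb : e y b by have := pathP x pp i lt_i; rewrite ny.
have ap : a \in x :: p := mem_nth x (ltnW lt_i1 : i.-1 < size (x :: p)).
have bp : b \in x :: p := mem_nth x (lt_i : i.+1 < size (x :: p)).
have ab : a != b.
  rewrite (nth_uniq x (ltnW lt_i1 : i.-1 < size (x :: p)) (lt_i : i.+1 < size (x :: p)) up).
  by rewrite ltn_eqF // ltnS leq_pred.
have: [set a; b; t] \subset [set w in R | sedge y w].
  apply/subsetP => w; rewrite !inE => /orP[/orP[]|] /eqP->.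
  - by rewrite (allP pR).
  - by rewrite (allP pR).
  - by rewrite tR.
move/subset_leq_card; rewrite -degE => /leq_trans/(_ (deg2 y _));
  rewrite (allP pR) // => /(_ isT).
rewrite setUC cardsU1 cards2 ab !inE.
have ta : t != a by apply: contraNneq tNp => ->.
have tb : t != b by apply: contraNneq tNp => ->.
by rewrite (negbTE ta) (negbTE tb).
Qed.

(** Apply [path_chord] to the part of the path that ends at [b]. *)
Lemma path_consecutive x p a b :
    path e x p -> uniq (x :: p) -> b \in x :: p -> sedge a b ->
  index a (x :: p) < index b (x :: p) -> (index a (x :: p)).+1 = index b (x :: p).
Proof.
move=> pp up bp; case/splitPl: bp pp up => p1 p2 lp1.
have eq_p : x :: p1 ++ p2 = belast x p1 ++ b :: p2.
  by rewrite -cat_cons lastI lp1 cat_rcons.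
rewrite cat_path => /andP[pp1 _] up.
have ib : index b (x :: p1 ++ p2) = size p1.
  move: up; rewrite eq_p cat_uniq => /and3P[_ /hasPn/(_ b) bNp1 _].
  by rewrite index_cat ifN ?bNp1 ?mem_head //= eqxx addn0 size_belast.
rewrite ib -cat_cons index_cat; case: ifP => [ap1|_] ab; last by rewrite /=; lia.
move=> _; apply: (path_chord acycG pp1 _ ap1); last by rewrite lp1.
by move: up; rewrite -cat_cons cat_uniq => /and3P[].
Qed.

(** [R] is a path, and the position of a vertex is the index of its projection on that path. A
    vertex is within [dl], hence within [k], of its projection, as [min_dist_spine] demands. *)
Lemma min_dist_retraction k m (f g : path_graph m.+1 -> G) :
    0 < k -> R != set0 -> {in R, forall z, deg R z <= 2} -> (forall x, dl x <= k) ->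
    surj_weak_hom f -> surj_weak_hom g ->
  min_dist f g <= k.
Proof.
move=> k_gt0 R_neq0 deg2 dl_k; have [x [p [pp up Rp]]] := spine R_neq0 deg2.
have pxp y : pi y \in x :: p by rewrite -Rp (retr_in retr).
pose pos y := index (pi y) (x :: p).
have posE y : y \in R -> pos y = index y (x :: p) by move=> yR;
  rewrite /pos (retr_id retr).
apply: (@min_dist_spine G k (size p) [in R] pos) => //.
- move=> a b ab; case: (retr_edge retr ab) => [[eq_ab _]|[aR bR]].
    by left; rewrite /pos eq_ab.
  rewrite !posE //; case: (ltngtP (index a (x :: p)) (index b (x :: p))) => i_ab;
    last by left.
    right; split=> //; left; apply: path_consecutive => //; by rewrite -Rp.
  right; split=> //; right; apply: path_consecutive; rewrite -?Rp // sedge_sym //.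
- move=> a b aR bR; rewrite !posE // => i_ab.
  by rewrite -(nth_index x (_ : a \in x :: p)) -?Rp // i_ab nth_index // -Rp.
- move=> r y rR; rewrite posE // => i_ry.
  have -> : r = pi y.
    by rewrite -(nth_index x (_ : r \in x :: p)) -?Rp // i_ry nth_index.
  by rewrite gdist_sym; split; exact: leq_trans (gdist_retraction _) (dl_k _).
- by move=> y; have := pxp y; rewrite -index_mem.
- by exists x; rewrite ?inE ?posE ?Rp ?mem_head //= eqxx.
- exists (last x p); rewrite ?posE ?Rp ?mem_last //.
  by rewrite (last_nth x) index_uniq.
Qed.

End Retraction.

(* Otherwise the connected set [R] would be the single edge [v p]. *)
Lemma peeling_leaf_step R pi dl lev v q c p :
    peeling R pi dl lev (v :: q) c -> p \in R -> sedge v p ->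
    (exists2 z, z \in R & 2 < deg R z) ->
  deg R p != 1.
Proof.
move=> peel pR vp [z zR dz]; apply: contraTneq dz => dp; rewrite -leqNgt.
have := peel_leaf peel v; rewrite mem_head => /esym/andP[vR /eqP dv].
have : z \in pred2 v p.
  apply: (@retraction_closed R pi dl (peel_retr peel) [in pred2 v p] v) zR => //.
    by rewrite inE eqxx.
  move=> a b aR bR /pred2P[]-> ab; rewrite inE.
    by rewrite (leaf_uniq bR pR ab vp dv) eqxx orbT.
  by rewrite (leaf_uniq bR vR ab _ dp) ?eqxx // sedge_sym.
by case/pred2P => ->; rewrite ?dv ?dp.
Qed.

(** What hung below [v] now hands below to [p], one level deeper. If [p] becomes a leaf it joins the
    end of the queue with level [lev v + 1]; the queue stays sorted because all its levels are at
    most [c], and [c] is at most [lev v + 1]. *)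
Lemma peeling_step R pi dl lev v q c p :
    peeling R pi dl lev (v :: q) c -> p \in R -> sedge v p ->
    (exists2 z, z \in R & 2 < deg R z) ->
  peeling (R :\ v) (fun x => if pi x == v then p else pi x)
    (fun x => dl x + (pi x == v)) (fun u => if u == p then (lev v).+1 else lev u)
    (q ++ if deg (R :\ v) p == 1 then [:: p] else [::]) (lev v).+1.
Proof.
move=> peel pR vp ex3; have dp := peeling_leaf_step peel pR vp ex3.
case: peel => retr /= /andP[vNq uq] leaf srt levb dep depl deep.
have := leaf v; rewrite mem_head => /esym/andP[vR /eqP dv].
have pv : p != v by apply: contraTneq vp => ->; rewrite sedge_irrefl.
have pNq : p \notin q.
  by have := leaf p; rewrite inE (negbTE dp) andbF => /negbT; rewrite negb_or => /andP[].
have only u : u \in R -> sedge u v -> u = p.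
  by rewrite sedge_sym => uR vu; exact: leaf_uniq vu vp dv.
have sortq : all (fun u => lev v <= lev u) q.
  by move: srt; rewrite path_sortedE;
    [case/andP => + _; rewrite all_map|exact: leq_trans].
have levq u : u \in q -> (u == p) = false by move=> uq0; apply: contraNF pNq => /eqP <-.
have memq u : u \in q -> (u \in v :: q) by rewrite inE => ->; rewrite orbT.
have [c_v _] := levb v (mem_head _ _).
have lev_le u : u \in q -> lev u <= (lev v).+1.
  by move=> /memq/levb[_ /leq_trans]; apply.
have dep_v x : pi x = v -> dl x < (lev v).+1.
  by move=> pxv; rewrite ltnS -pxv depl // pxv mem_head.
set tl := if _ then _ else _.
have mem_tl u : u \in tl -> u = p by rewrite /tl; case: ifP => // _; rewrite inE => /eqP.
split.
- split=> [x|x|x|x y|x].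
  + by rewrite !inE; have [_|pxv] := eqVneq (pi x) v; rewrite ?pv ?pxv // (retr_in retr).
  + by rewrite !inE => /andP[xv xR]; rewrite (retr_id retr) // (negbTE xv).
  + by rewrite !inE => /andP[xv xR];
      rewrite (retr_id retr) // (negbTE xv) (retr_depth0 retr).
  + move=> xy; case: (retr_edge retr xy) => [[-> dxy]|[xR yR]]; first by left;
      rewrite -addSn leq_add2r.
    rewrite !(retr_id retr) // !(retr_depth0 retr) // !inE.
    have [xv|xv] := eqVneq x v; have [yv|yv] := eqVneq y v; last by right.
    * by subst x y; rewrite sedge_irrefl in xy.
    * by left; subst x; rewrite (leaf_uniq yR pR xy vp dv).
    * by left; subst y; rewrite (only x xR xy).
  + have [r [pr lr] sr] := retr_walk retr x; case: eqP => [pxv|_]; last by exists r;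
      rewrite ?addn0.
    by exists (rcons r p);
      rewrite ?rcons_path ?last_rcons ?size_rcons ?pr ?lr ?pxv ?sr ?addn1.
- rewrite cat_uniq uq /=; apply/andP; split.
    by apply/hasPn => u /mem_tl ->.
  by rewrite /tl; case: ifP.
- move=> u; rewrite mem_cat !inE.
  have [->|up] := eqVneq u p.
    by rewrite (negbTE pNq) pv pR /= /tl; case: ifP; rewrite // mem_head.
  have -> : (u \in tl) = false by apply: contraNF up => /mem_tl ->.
  have := leaf u; rewrite inE orbF; have [->|uv] := eqVneq u v;
    first by rewrite (negbTE vNq).
  move=> /= ->; have [uR /=|//] := boolP (u \in R).
  rewrite {1}/deg (nsumD1 _ _ vR); case: (boolP (sedge u v)) => [/(only u uR) eup|//].
  by rewrite eup eqxx in up.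
- rewrite map_cat (_ : map _ q = map lev q); last first.
    by apply/eq_in_map => u /levq ->.
  have {srt} : sorted leq (map lev q) by move: srt; exact: path_sorted.
  move=> srt; rewrite (sorted_pairwise leq_trans) pairwise_cat -!(sorted_pairwise leq_trans) srt andTb.
  apply/andP; split; last by rewrite /tl; case: ifP.
  by apply/allrelP => _ _ /mapP[u uq0 ->] /mapP[w /mem_tl -> ->]; rewrite eqxx lev_le.
- move=> u; rewrite mem_cat => /orP[uq0|/mem_tl ->]; last by rewrite eqxx leqnSn.
  by rewrite levq // ltnS lev_le ?(allP sortq).
- move=> x; have [pxv|_] := eqVneq (pi x) v; first by rewrite addn1 dep_v.
  by rewrite addn0; exact: leq_trans (dep x) c_v.
- move=> x; have [pxv|pxv] := eqVneq (pi x) v; first by rewrite eqxx addn1 dep_v.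
  rewrite addn0 mem_cat; have [->|pxp] := eqVneq (pi x) p.
    by move=> _; exact: leq_trans (dep x) c_v.
  by case/orP => [/memq/depl//|/mem_tl/eqP]; rewrite (negbTE pxp).
move=> u; rewrite mem_cat => /orP[uq0|/mem_tl ->].
  have [x px lx] := deep u (memq _ uq0); exists x.
    by rewrite px; case: eqP => // uv; rewrite -uv uq0 in vNq.
  by rewrite levq // (leq_trans lx) ?leq_addr.
have [x px lx] := deep v (mem_head _ _); exists x; first by rewrite px eqxx.
by rewrite px !eqxx addn1 ltnS.
Qed.

End Peeling.

(** * What a peeling says about the span *)

Section PeelingOutcome.
Variable G : sgraph.
Hypothesis conG : forall x y : G, connect (@sedge G) x y.
Hypothesis acycG : acyclic G.
Variables (R : {set G}) (pi : G -> G) (dl lev : G -> nat).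

Definition branching (A : {set G}) : {set G} := [set z in A | 2 < deg A z].

(** Ensures that the queue is not empty while the deletion loop runs. *)
Lemma branching_leaf z : z \in branching R -> exists2 u, u \in R & deg R u = 1.
Proof.
rewrite inE => /andP[zR dz]; have /deg_gt0P[w wR zw] : 0 < deg R z by exact: ltn_trans dz.
by have [u /andP[uR /eqP du] _] := leaf_in_branch acycG zR wR zw; exists u.
Qed.

(** The head of the sorted queue has the least level, so below every leaf of [R] some vertex hangs
    at depth at least [lev v]. *)
Lemma peeling_svs v q c z :
  peeling R pi dl lev (v :: q) c -> z \in branching R -> svs_at_least G (lev v).+1.
Proof.
move=> peel; rewrite inE => /andP[zR dz].
apply: (svs_at_least_retraction conG acycG (peel_retr peel) zR dz) => u uR du.
have uq : u \in v :: q by rewrite (peel_leaf peel) uR du.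
have [x px lx] := peel_deep peel uq; exists x => //; rewrite ltnS (leq_trans _ lx) //.
have := peel_sorted peel; rewrite /= path_sortedE; last exact: leq_trans.
rewrite all_map => /andP[/allP srt _].
by move: uq; rewrite inE => /predU1P[->//|/srt].
Qed.

(** All depths are at most [c]; the maximum with 1 is there because the spine argument needs a
    positive bound. *)
Lemma peeling_upper q c m (f g : path_graph m.+1 -> G) :
    peeling R pi dl lev q c -> branching R = set0 ->
    surj_weak_hom f -> surj_weak_hom g ->
  min_dist f g <= maxn c 1.
Proof.
move=> peel B0; have retr := peel_retr peel.
apply: (min_dist_retraction conG acycG retr) => [||z zR|x].
- by rewrite leq_max orbT.
- by apply/set0Pn; exists (pi (f ord0)); exact: retr_in retr _.
- by rewrite leqNgt; apply/negP => dz; have := in_set0 z; rewrite -B0 inE zR dz.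
- by rewrite leq_max (peel_depth peel).
Qed.

Lemma deg_remove v p u : v \in R -> deg R v = 1 -> p \in R -> sedge v p ->
  u \in R -> forall F, nsum R F u = (u == p) * F v + nsum (R :\ v) F u.
Proof.
move=> vR dv pR vp uR F; rewrite (nsumD1 _ _ vR) sedge_sym.
by congr (nat_of_bool _ * _ + _); apply/idP/eqP => [vu|->//]; exact: leaf_uniq vu vp dv.
Qed.

(** Only [p] loses a neighbour, and it stops being branching exactly when its degree falls from 3 to
    2. *)
Lemma branching_remove v p : v \in R -> deg R v = 1 -> p \in R -> sedge v p ->
  #|branching R| = #|branching (R :\ v)| + (deg (R :\ v) p == 2).
Proof.
move=> vR dv pR vp; have pv : p != v by apply: contraTneq vp => ->; rewrite sedge_irrefl.
have degS u : u \in R -> deg R u = (u == p) + deg (R :\ v) u.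
  by move=> uR; rewrite /deg (deg_remove vR dv pR vp uR) muln1.
have eq_u u : u \in branching R = (u \in branching (R :\ v)) || (u == p) && (deg (R :\ v) p == 2).
  rewrite !inE; have [->|uv] := eqVneq u v;
    first by rewrite dv [v == p]eq_sym (negbTE pv) andbF.
  have [uR|uNR] /= := boolP (u \in R); last by case: eqP => // up; rewrite up pR in uNR.
  rewrite degS //; have [->|_] := eqVneq u p; last by rewrite orbF.
  by rewrite add1n ltnS leq_eqVlt orbC eq_sym.
have [d2|dN2] := eqVneq (deg (R :\ v) p) 2.
  rewrite (_ : branching R = p |: branching (R :\ v)).
    by rewrite cardsU1 addnC !inE d2 ltnn !andbF.
  by apply/setP => u; rewrite in_setU1 eq_u d2 eqxx andbT orbC.
by rewrite addn0; congr #|pred_of_set _|; apply/setP => u;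
  rewrite eq_u (negbTE dN2) andbF orbF.
Qed.

End PeelingOutcome.

(** * Programs *)

Section Runs.
Variable W : nat.
Implicit Types (st : state) (e : expr) (c : cmd) (Q : state -> Prop).

Fixpoint den st e : nat :=
  match e with
  | Lit k => k
  | Reg r => regs st r
  | Add e1 e2 => den st e1 + den st e2
  | Sub e1 e2 => den st e1 - den st e2
  | Fetch e1 => mem st (den st e1)
  end.

Fixpoint safe st e : Prop :=
  match e with
  | Lit k => k < W
  | Reg r => regs st r < W
  | Add e1 e2 => [/\ safe st e1, safe st e2 & den st e1 + den st e2 < W]
  | Sub e1 e2 => safe st e1 /\ safe st e2
  | Fetch e1 => safe st e1 /\ mem st (den st e1) < W
  end.

Lemma safe_lt st e : safe st e -> den st e < W.
Proof.
elim: e => [k|r|e1 _ e2 _|e1 IH1 e2 _|e1 _] //=; [by case| |by case].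
by case=> /IH1 lt1 _; exact: leq_ltn_trans (leq_subr _ _) lt1.
Qed.

Lemma evalE st e : safe st e -> eval W st e = Some (den st e).
Proof.
elim: e => [k|r|e1 IH1 e2 IH2|e1 IH1 e2 IH2|e1 IH1] /=; rewrite /word.
- by move=> ->.
- by move=> ->.
- by case=> /IH1 -> /IH2 -> /= ->.
- case=> s1 /IH2 ->; rewrite (IH1 s1) /= (leq_ltn_trans (leq_subr _ _)) //.
  exact: safe_lt.
- by case=> /IH1 -> /= ->.
Qed.

(** A time bound for loop-free commands, charging both branches of a test. Loops are treated by
    [run_while], and their value 0 here is a placeholder. *)
Fixpoint cost c : nat :=
  match c with
  | Skip => 1
  | Assign _ e => (ecost e).+1
  | Store e1 e2 => (ecost e1 + ecost e2).+1
  | Seq c1 c2 => cost c1 + cost c2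
  | If e c1 c2 => (ecost e).+1 + (cost c1 + cost c2)
  | While _ _ => 0
  end.

Definition run c N st Q : Prop :=
  exists t st', [/\ exec W st c t st', t <= N & Q st'].

Lemma run_skip st Q : Q st -> run Skip (cost Skip) st Q.
Proof. by exists 1, st; split=> //; exact: ExecSkip. Qed.

Lemma run_assign r e v st Q :
    safe st e -> den st e = v -> Q (State (upd (regs st) r v) (mem st)) ->
  run (Assign r e) (cost (Assign r e)) st Q.
Proof.
move=> se <- Qst; exists (ecost e).+1; eexists; split; last exact: Qst; last by [].
by apply: ExecSet; exact: evalE.
Qed.

Lemma run_store e1 e2 a v st Q :
    safe st e1 -> safe st e2 -> den st e1 = a -> den st e2 = v ->
    Q (State (regs st) (upd (mem st) a v)) ->
  run (Store e1 e2) (cost (Store e1 e2)) st Q.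
Proof.
move=> s1 s2 <- <- Qst; exists (ecost e1 + ecost e2).+1; eexists.
by split; last exact: Qst; [apply: ExecStore; exact: evalE|].
Qed.

Lemma run_seq c1 c2 N1 N2 st Q :
  run c1 N1 st (fun st1 => run c2 N2 st1 Q) -> run (Seq c1 c2) (N1 + N2) st Q.
Proof.
case=> t1 [st1 [ex1 le1 [t2 [st2 [ex2 le2 Q2]]]]].
by exists (t1 + t2), st2; split; [exact: ExecSeq ex1 ex2|exact: leq_add|].
Qed.

Lemma run_block c1 c2 st Q :
    run c1 (cost c1) st (fun st1 => run c2 (cost c2) st1 Q) ->
  run (Seq c1 c2) (cost (Seq c1 c2)) st Q.
Proof. exact: run_seq. Qed.

(** [k] bounds the number of iterations left; the last summand pays for the final, failing test. *)
Lemma run_while (I : nat -> state -> Prop) e c k st Q :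
    (forall k st, I k st -> safe st e) ->
    (forall k st, I k st -> den st e = 0 -> Q st) ->
    (forall k st, I k st -> den st e != 0 -> 0 < k /\ run c (cost c) st (I k.-1)) ->
    I k st ->
  run (While e c) (k * ((ecost e).+1 + cost c) + (ecost e).+1) st Q.
Proof.
move=> Isafe Istop Istep.
elim: k st => [|k IHk] st Ist; have se := Isafe _ _ Ist;
  have [d0|dn0] := eqVneq (den st e) 0.
- exists (ecost e).+1, st; split=> //; last exact: Istop Ist d0.
  by apply: ExecWhileStop; rewrite evalE ?d0.
- by have [] := Istep _ _ Ist dn0.
- exists (ecost e).+1, st; split=> //; last exact: Istop Ist d0.
    by apply: ExecWhileStop; rewrite evalE ?d0.
  exact: leq_addl.
have [_ [t1 [st1 [ex1 le1 I1]]]] := Istep _ _ Ist dn0.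
have [t2 [st2 [ex2 le2 Q2]]] := IHk _ I1.
exists ((ecost e).+1 + (t1 + t2)), st2; split=> //.
  exact: ExecWhileStep (evalE se) dn0 ex1 ex2.
by rewrite mulSn -!addnA leq_add2l leq_add.
Qed.

End Runs.

Arguments cost : simpl never.

(** * The program *)

Definition block : seq cmd -> cmd := foldr Seq Skip.

(** Subtraction being truncated, one term vanishes and the value is the absolute difference, nonzero
    exactly for different values. *)
Definition neq (e1 e2 : expr) : expr := Add (Sub e1 e2) (Sub e2 e1).
Definition cell (b : nat) (i : expr) : expr := Fetch (Add (Reg b) i).
Definition put (b : nat) (i v : expr) : cmd := Store (Add (Reg b) i) v.

(* With n vertices, the cells 4n + v and 5n + v hold the degree of the vertex v
   and the sum of its neighbours among the remaining vertices (so that the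
   neighbour of a leaf is read off without adjacency lists), 6n + v the
   round in which v became a leaf, and the queue of leaves starts at 7n.
   Register 2 is the tail of the queue, 3 its head, 4 to 7 are the array bases,
   8 counts the vertices of degree at least 3, and 9 is the number of
   rounds. *)
Definition init_cmd : seq cmd :=
  [:: Assign 4 (Add (Add (Reg 0) (Reg 0)) (Add (Reg 0) (Reg 0)));
      Assign 5 (Add (Reg 4) (Reg 0));
      Assign 6 (Add (Reg 5) (Reg 0));
      Assign 7 (Add (Reg 6) (Reg 0))].

(* An edge has distinct ends, so the first cell pair with equal contents marks
   the end of the input. *)
Definition read_test : expr := neq (Fetch (Reg 1)) (Fetch (Add (Reg 1) (Lit 1))).
Definition read_body : cmd := block
  [:: Assign 10 (Fetch (Reg 1));
      Assign 11 (Fetch (Add (Reg 1) (Lit 1)));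
      put 4 (Reg 10) (Add (cell 4 (Reg 10)) (Lit 1));
      put 5 (Reg 10) (Add (cell 5 (Reg 10)) (Reg 11));
      put 4 (Reg 11) (Add (cell 4 (Reg 11)) (Lit 1));
      put 5 (Reg 11) (Add (cell 5 (Reg 11)) (Reg 10));
      Assign 1 (Add (Reg 1) (Lit 2))].

Definition scan_test : expr := Sub (Reg 0) (Reg 1).
(** Truncated subtraction supplies indicators: 1 - |d - 1| for d = 1, and 1 - (3 - d) for d at least
    3. The vertex is always written at the tail of the queue, but the tail moves only for a leaf. *)
Definition scan_body : cmd := block
  [:: Assign 12 (cell 4 (Reg 1));
      put 7 (Reg 2) (Reg 1);
      Assign 2 (Add (Reg 2) (Sub (Lit 1) (neq (Reg 12) (Lit 1))));
      Assign 8 (Add (Reg 8) (Sub (Lit 1) (Sub (Lit 3) (Reg 12))));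
      Assign 1 (Add (Reg 1) (Lit 1))].

Definition peel_test : expr := Reg 8.
(* The stores to the queue and to the round array are unconditional: when the
   neighbour is not yet a leaf, they write garbage that is overwritten before
   it is read. *)
Definition peel_body : cmd := block
  [:: Assign 10 (cell 7 (Reg 3));
      Assign 3 (Add (Reg 3) (Lit 1));
      Assign 9 (Add (cell 6 (Reg 10)) (Lit 1));
      Assign 11 (cell 5 (Reg 10));
      put 5 (Reg 11) (Sub (cell 5 (Reg 11)) (Reg 10));
      Assign 12 (Sub (cell 4 (Reg 11)) (Lit 1));
      put 4 (Reg 11) (Reg 12);
      Assign 8 (Sub (Reg 8) (Sub (Lit 1) (neq (Reg 12) (Lit 2))));
      put 7 (Reg 2) (Reg 11);
      put 6 (Reg 11) (Reg 9);
      Assign 2 (Add (Reg 2) (Sub (Lit 1) (neq (Reg 12) (Lit 1))))].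

(** With h rounds in register 9, the last expression is h + (1 - h) = max(h, 1) for n at least 2,
    and 0 for n = 1 and h = 0. *)
Definition svs_cmd : cmd := block (init_cmd ++
  [:: While read_test read_body;
      Assign 1 (Lit 0);
      While scan_test scan_body;
      While peel_test peel_body;
      Assign 0 (Add (Reg 9) (Sub (Sub (Lit 1) (Reg 9))
                                 (Sub (Lit 1) (Sub (Reg 0) (Lit 1)))))]).


Lemma upd_neq f a v b : b <> a -> upd f a v b = f b.
Proof. by move=> /eqP ba; rewrite /upd (negbTE ba). Qed.

Ltac is_numeral k := lazymatch k with O => idtac | S ?j => is_numeral j end.

(* Resolves the register accesses [upd f a v b] with numerals [a], [b]; memory
   accesses have symbolic addresses and are left alone. *)
Ltac regs := rewrite /=; repeat match goal with
  |- context [upd ?f ?a ?v ?b] =>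
    is_numeral a; is_numeral b;
    let t := eval compute in (b == a) in
    lazymatch t with
    | true => change (upd f a v b) with v
    | false => change (upd f a v b) with (f b)
    end
  end.

(** * The linear-time algorithm *)

Section Program.
Variables (T : sgraph) (n W : nat) (nm : T -> nat) (s : seq (T * T)).
Hypothesis card_T : #|T| = n.
Hypothesis nm_lt : forall u, nm u < n.
Hypothesis nm_inj : injective nm.
Hypothesis nm_surj : forall i, i < n -> exists u, nm u = i.
Hypothesis W_gt : n * n + 8 * n + 8 < W.
Hypothesis treeT : is_tree T.
Hypothesis edges_s : edge_list s.

Let conT := proj2 (proj1 treeT).
Let acycT := proj2 treeT.

Let n_gt0 : 0 < n.
Proof. by rewrite -card_T; have [[]] := treeT. Qed.

Let input := nth 0 (flatten [seq [:: nm uv.1; nm uv.2] | uv <- s]).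

(** As [nm v < n], division by [n] recovers the array and the vertex from the address. *)
Lemma upd_cell m k v x k' u :
  upd m (k * n + nm v) x (k' * n + nm u) =
  if (k' == k) && (u == v) then x else m (k' * n + nm u).
Proof.
rewrite /upd; congr (if _ then _ else _).
apply/eqP/andP => [eq_kv|[/eqP -> /eqP ->] //].
have eq_k := congr1 (divn^~ n) eq_kv.
rewrite !divnMDl // !divn_small // !addn0 in eq_k.
by split; apply/eqP => //; apply: nm_inj; apply: (@addnI (k * n)); rewrite -{1}eq_k.
Qed.

Lemma upd_queue m i x k u : k < 7 -> upd m (7 * n + i) x (k * n + nm u) = m (k * n + nm u).
Proof. by move=> lt_k; apply: upd_neq; have := nm_lt u; nia. Qed.

(** The contents of the degree and neighbour-sum arrays once the edges in [r] have been read. *)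
Definition incidence (r : seq (T * T)) (F : T -> nat) (u : T) : nat :=
  \sum_(ab <- r) ((ab.1 == u) * F ab.2 + (ab.2 == u) * F ab.1).

(** Write [sedge] as the number of occurrences of both orientations in [s] and exchange the two
    sums. *)
Lemma incidence_edges F u : incidence s F u = nsum setT F u.
Proof.
rewrite /nsum (eq_bigl xpredT) => [|w]; last by rewrite inE.
under eq_bigr => w _ do rewrite -edges_s -!sum1_count !(big_mkcond (pred1 _)) -big_split big_distrl /=.
rewrite exchange_big /=; apply: eq_bigr => -[a b] _ /=.
under eq_bigr => w _ do rewrite mulnDl; rewrite big_split /=; congr (_ + _).
  rewrite (bigD1 b) //= big1 ?addn0 => [|w wb]; first by rewrite xpair_eqE eqxx andbT;
    case: eqP.
  by rewrite xpair_eqE [b == w]eq_sym (negbTE wb) andbF.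
rewrite (bigD1 a) //= big1 ?addn0 => [|w wa]; first by rewrite xpair_eqE eqxx; case: eqP.
by rewrite xpair_eqE [a == w]eq_sym (negbTE wa).
Qed.

Lemma incidence_rcons r ab F u : incidence (rcons r ab) F u =
  incidence r F u + ((ab.1 == u) * F ab.2 + (ab.2 == u) * F ab.1).
Proof. by rewrite /incidence -cats1 big_cat big_seq1. Qed.

Lemma deg_le (R : {set T}) u : deg R u <= n.
Proof. by rewrite degE -card_T max_card. Qed.

Lemma nsum_le (R : {set T}) u : nsum R nm u <= n * n.
Proof.
rewrite /nsum -{1}card_T -sum_nat_const big_mkcond leq_sum // => w _.
by have := nm_lt w; case: (w \in R); case: (sedge u w); rewrite ?mul1n ?mul0n //;
  exact: ltnW.
Qed.

Lemma incidence_le s1 s2 F u : s = s1 ++ s2 -> incidence s1 F u <= nsum setT F u.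
Proof. by rewrite -incidence_edges => ->; rewrite /incidence big_cat leq_addr. Qed.

(** Both sides of the degree bound for forests are halved. This bounds the reading loop and keeps
    the input, with the pair of cells after it, below the arrays. *)
Lemma size_edges : size s <= n.
Proof.
have := sum_deg_le acycT setT; rewrite cardsT card_T.
rewrite (eq_bigl xpredT) => [|w]; last by rewrite inE.
under eq_bigr => u _ do rewrite /deg -incidence_edges.
have one (a : T) : \sum_u (a == u) * 1 = 1.
  by rewrite (bigD1 a) //= eqxx big1 // => u ua; rewrite eq_sym (negbTE ua).
rewrite /incidence exchange_big /=.
under eq_bigr => ab _ do rewrite big_split /= !one.
by rewrite big_const_seq count_predT iter_addn_0 leq_pmul2l.
Qed.

Lemma edge_mem u v : (u, v) \in s -> sedge u v.
Proof.
rewrite -has_pred1 has_count => c; have := edges_s u v.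
by case: (sedge u v) => // /eqP; rewrite addn_eq0 => /andP[/eqP e0]; rewrite e0 in c.
Qed.

Lemma input_cat s1 s2 j : s = s1 ++ s2 ->
  input (2 * size s1 + j) = nth 0 (flatten [seq [:: nm uv.1; nm uv.2] | uv <- s2]) j.
Proof.
move=> es; rewrite /input es map_cat flatten_cat nth_cat.
have -> : size (flatten [seq [:: nm uv.1; nm uv.2] | uv <- s1]) = 2 * size s1.
  by elim: s1 {es} => //= a r ->; rewrite mulnS.
by rewrite ltnNge leq_addr /= addKn.
Qed.

(** * Reading the edge list *)

Definition layout st :=
  [/\ regs st 0 = n, regs st 4 = 4 * n, regs st 5 = 5 * n, regs st 6 = 6 * n
    & regs st 7 = 7 * n].


Lemma upd_cell_queue m k v x j : k < 7 ->
  upd m (k * n + nm v) x (7 * n + j) = m (7 * n + j).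
Proof. by move=> lt_k; apply: upd_neq; have := nm_lt v; nia. Qed.

(** Addresses and counters are linear in [n]; only the neighbour sums need the quadratic bound
    [W_sq]. *)
Lemma W_lin i : i <= 8 * n + 8 -> i < W.
Proof. lia. Qed.

Lemma W_sq i : i <= n * n -> i < W.
Proof. lia. Qed.

Definition reading k st :=
  exists s1 s2, [/\ s = s1 ++ s2, k = size s2, layout st,
    [/\ regs st 1 = 2 * size s1, regs st 2 = 0, regs st 3 = 0, regs st 8 = 0
      & regs st 9 = 0]
    & (forall a, a < 4 * n -> mem st a = input a) /\
      (forall u, [/\ mem st (4 * n + nm u) = incidence s1 (fun=> 1) u,
        mem st (5 * n + nm u) = incidence s1 nm u & mem st (6 * n + nm u) = 0])].

(** Past the last edge both cells still lie below [4 * n] and hold the default 0, so the test fails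
    there. *)
Lemma reading_fetch k st : reading k st ->
  exists s1 s2, [/\ s = s1 ++ s2, k = size s2, regs st 1 = 2 * size s1 &
    [/\ size s1 <= n, mem st (regs st 1) = nth 0 [seq nm uv.1 | uv <- s2] 0
     & mem st (regs st 1 + 1) = nth 0 [seq nm uv.2 | uv <- s2] 0]].
Proof.
case=> s1 [s2 [es ek _ [r1 _ _ _ _] [inp _]]]; exists s1, s2; split=> //.
have sz1 : size s1 <= n by have := size_edges; rewrite es size_cat; lia.
rewrite r1 !inp; [|clear -sz1 n_gt0; lia..].
rewrite -[2 * _]addn0 -addnA !(input_cat _ es) sz1.
by case: (s2) => [|[]].
Qed.

Lemma reading_safe k st : reading k st -> safe W st read_test.
Proof.
move=> /reading_fetch[s1 [s2 [es _ r1 [sz1 m1 m2]]]] /=; rewrite m1 m2 r1.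
have lt1 : nth 0 [seq nm uv.1 | uv <- s2] 0 < n.
  by case: (s2) => [|[a b] r] /=; rewrite ?nm_lt // -card_T; have [[]] := treeT.
have lt2 : nth 0 [seq nm uv.2 | uv <- s2] 0 < n.
  by case: (s2) => [|[a b] r] /=; rewrite ?nm_lt // -card_T; have [[]] := treeT.
clear -lt1 lt2 sz1 W_gt; repeat split; lia.
Qed.

Lemma reading_step k st : reading k st -> den st read_test != 0 ->
  0 < k /\ run W read_body (cost read_body) st (reading k.-1).
Proof.
move=> rd; have [s1' [s2' [_ ek' _ [sz1 _ _]]]] := reading_fetch rd.
case: rd => s1 [s2 [es ek [h0 h4 h5 h6 h7] [r1 r2 r3 r8 r9] [inp arr]]].
have sz : size s1 <= n by have := size_edges; rewrite es size_cat; clear; lia.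
have lt1 : 2 * size s1 < 4 * n by clear -sz n_gt0; lia.
have lt2 : 2 * size s1 + 1 < 4 * n by clear -sz n_gt0; lia.
have in1 := inp _ lt1; rewrite -[X in input X]addn0 (input_cat _ es) in in1.
have in2 := inp _ lt2; rewrite (input_cat _ es) in in2.
rewrite /= r1 in1 in2 ek.
case: s2 es in1 in2 {ek ek' sz1 s1' s2'} => [|[x y] s2] //= es in1 in2.
move=> _; split=> //.
have xy : sedge x y by apply: edge_mem; rewrite es mem_cat mem_head orbT.
have nxy : (y == x) = false by apply: contraTF xy => /eqP ->; rewrite sedge_irrefl.
have es' : s = rcons s1 (x, y) ++ s2 by rewrite cat_rcons.
have lx := nm_lt x; have ly := nm_lt y.
have [ax bx _] := arr x; have [ay by_ _] := arr y.
have dle (u : T) : incidence (rcons s1 (x, y)) (fun=> 1) u <= n.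
  exact: leq_trans (incidence_le _ _ es') (deg_le _ _).
have sle (u : T) : incidence (rcons s1 (x, y)) nm u <= n * n.
  exact: leq_trans (incidence_le _ _ es') (nsum_le _ _).
have := dle x; have := dle y; have := sle x; have := sle y.
rewrite !incidence_rcons /= !eqxx [x == y]eq_sym nxy !mul1n !mul0n !addn0 add0n.
move=> sy sx dy dx.
(* Symbolic execution of the loop body; each command leaves the goal that its intermediate values
   are below [W]. *)
apply: run_block; apply: (@run_assign _ _ _ (nm x)); rewrite /= ?r1 ?in1 //.
  by split; apply: W_lin; clear -lx sz; lia.
apply: run_block; apply: (@run_assign _ _ _ (nm y)); regs; rewrite ?r1 ?in2 //.
  by repeat split; apply: W_lin; clear -ly sz; lia.
apply: run_block; apply: (@run_store _ _ _ (4 * n + nm x) (incidence s1 (fun=> 1) x + 1));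
  regs; rewrite ?h4 ?ax //.
- by repeat split; apply: W_lin; clear -lx; lia.
- by repeat split; apply: W_lin; clear -lx dx; lia.
apply: run_block; apply: (@run_store _ _ _ (5 * n + nm x) (incidence s1 nm x + nm y));
  regs; rewrite ?h5 ?upd_cell /= ?bx //.
- by repeat split; apply: W_lin; clear -lx; lia.
- by repeat split; first [apply: W_lin; clear -lx ly; lia | apply: W_sq; clear -sx; lia].
apply: run_block; apply: (@run_store _ _ _ (4 * n + nm y) (incidence s1 (fun=> 1) y + 1));
  regs; rewrite ?h4 ?upd_cell /= ?nxy ?ay //.
- by repeat split; apply: W_lin; clear -ly; lia.
- by repeat split; apply: W_lin; clear -ly dy; lia.
apply: run_block; apply: (@run_store _ _ _ (5 * n + nm y) (incidence s1 nm y + nm x));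
  regs; rewrite ?h5 ?upd_cell /= ?nxy ?by_ //.
- by repeat split; apply: W_lin; clear -ly; lia.
- by repeat split; first [apply: W_lin; clear -lx ly; lia | apply: W_sq; clear -sy; lia].
apply: run_block; apply: (@run_assign _ _ _ (2 * size s1 + 2)); regs; rewrite ?r1 //.
  by repeat split; apply: W_lin; clear -sz n_gt0; lia.
apply: run_skip; exists (rcons s1 (x, y)), s2; split=> //.
- by split; regs; rewrite ?size_rcons ?mulnS 1?addnC.
split=> [a lt_a|u] /=.
  by rewrite !upd_neq ?inp // => ea; move: lt_a; rewrite ea ltnNge; apply/negP;
    rewrite negbK (leq_trans _ (leq_addr _ _)) // leq_mul2r ?orbT.
rewrite !upd_cell /= !incidence_rcons /=; have [au bu cu] := arr u.
rewrite au bu cu ![_ == u]eq_sym !muln1.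
have [->|ux] := eqVneq u x; first by rewrite [x == y]eq_sym nxy mul1n !addn0.
by have [->|uy] := eqVneq u y; rewrite ?mul1n ?mul0n ?addn0 ?add0n.
Qed.

(** * Collecting the leaves *)

Definition leaves_below i u := (nm u < i) && (deg [set: T] u == 1).
Definition branching_below i := [set u | (nm u < i) && (2 < deg [set: T] u)].

Definition scanning k st :=
  exists (i : nat) (q : seq T), [/\ i + k = n, layout st,
    [/\ regs st 1 = i, regs st 2 = size q, regs st 3 = 0,
        regs st 8 = #|branching_below i| & regs st 9 = 0],
    uniq q /\ (forall u, (u \in q) = leaves_below i u)
    & (forall u, [/\ mem st (4 * n + nm u) = deg setT u,
        mem st (5 * n + nm u) = nsum setT nm u & mem st (6 * n + nm u) = 0]) /\
      (forall j, j < size q -> mem st (7 * n + j) = nth 0 (map nm q) j)].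

Lemma uniq_size (q : seq T) : uniq q -> size q <= n.
Proof. by move=> /card_uniqP <-; rewrite -card_T max_card. Qed.

(** At an unread edge the test could fail only if both ends had the same number, which irreflexivity
    excludes; so all edges have been read. *)
Lemma reading_stop k st : reading k st -> den st read_test = 0 ->
  scanning n (State (upd (regs st) 1 0) (mem st)).
Proof.
move=> rd; have [s1 [s2 [es _ r1 [_ m1 m2]]]] := reading_fetch rd.
rewrite /= m1 m2; case: s2 es {m1 m2} => [|[x y] s2] es /=; last first.
  have xy : sedge x y by apply: edge_mem; rewrite es mem_cat mem_head orbT.
  move/eqP; rewrite addn_eq0 !subn_eq0 -eqn_leq => /eqP/nm_inj exy.
  by rewrite exy sedge_irrefl in xy.
move=> _; case: rd => t1 [t2 [et _ [h0 h4 h5 h6 h7] [r1' r2 r3 r8 r9] [_ arr]]].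
have et1 : t1 = s.
  have sz : size t1 = size s1 by apply/eqP; rewrite -(eqn_pmul2l (isT : 0 < 2)) -r1 -r1'.
  rewrite cats0 in es; rewrite -es et size_cat in sz *.
  have /size0nil -> : size t2 = 0 by move/eqP: sz;
    rewrite -{1}[size t1]addn0 eqn_add2l => /eqP.
  by rewrite cats0.
exists 0, [::]; split=> //.
- split=> //; regs; rewrite r8; apply/esym/eqP; rewrite cards_eq0; apply/eqP/setP => u.
  by rewrite !inE.
- by split=> // u; have [-> -> ->] := arr u; rewrite et1 !incidence_edges.
Qed.

Lemma scanning_safe k st : scanning k st -> safe W st scan_test.
Proof.
case=> i [q [ik [h0 _ _ _ _] [r1 _ _ _ _] _ _]] /=; rewrite h0 r1.
by split; apply: W_lin; clear -ik; lia.
Qed.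

Lemma scanning_step k st : scanning k st -> den st scan_test != 0 ->
  0 < k /\ run W scan_body (cost scan_body) st (scanning k.-1).
Proof.
case=> i [q [ik [h0 h4 h5 h6 h7] [r1 r2 r3 r8 r9] [uq mq] [arr queue]]].
rewrite /= h0 r1 subn_eq0 -ltnNge => lt_i; have k_gt0 : 0 < k by clear -lt_i ik; lia.
split=> //; have [u nu] := nm_surj lt_i.
have du := deg_le setT u; have sq := uniq_size uq.
have bb : #|branching_below i| <= n by rewrite -card_T max_card.
have [au _ _] := arr u; set d := deg _ u in du au.
apply: run_block; apply: (@run_assign _ _ _ d); rewrite /= ?h4 ?r1 -?nu ?au //.
  by repeat split; apply: W_lin; clear -du nu lt_i; lia.
apply: run_block; apply: (@run_store _ _ _ (7 * n + size q) (nm u)); regs;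
  rewrite ?h7 ?r2 ?r1 ?nu //.
- by repeat split; apply: W_lin; clear -sq; lia.
- by apply: W_lin; clear -lt_i; lia.
apply: run_block; apply: (@run_assign _ _ _ (size q + (d == 1))); regs; rewrite ?r2.
- by repeat split; apply: W_lin; clear -sq du; lia.
- by clear; lia.
apply: run_block; apply: (@run_assign _ _ _ (#|branching_below i| + (2 < d))); regs;
  rewrite ?r8.
- by repeat split; apply: W_lin; clear -bb du; lia.
- by clear; lia.
apply: run_block; apply: (@run_assign _ _ _ i.+1); regs; rewrite ?r1 ?addn1 //.
  by repeat split; apply: W_lin; clear -lt_i; lia.
apply: run_skip.
have below w : (nm w < i.+1) = (nm w < i) || (w == u).
  by rewrite ltnS leq_eqVlt orbC -nu (inj_eq nm_inj).
have uNq : u \notin q by rewrite mq /leaves_below nu ltnn.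
exists i.+1, (if d == 1 then rcons q u else q); split=> //.
- by rewrite -ik -{2}(prednK k_gt0) addnS.
- split=> //.
    by regs; case: eqP; rewrite ?size_rcons ?addn1 ?addn0.
  regs; have [d2|dN2] := boolP (2 < d).
    rewrite (_ : branching_below i.+1 = u |: branching_below i).
      by rewrite cardsU1 inE nu ltnn addnC.
    by apply/setP => w; rewrite !inE below andb_orl orbC; have [->|//] := eqVneq w u;
      rewrite d2.
  rewrite addn0; congr #|pred_of_set _|; apply/setP => w; rewrite !inE below andb_orl.
  by have [->|_] := eqVneq w u; rewrite ?orbF // (negbTE dN2) !andbF.
- split; first by case: ifP; rewrite ?rcons_uniq ?uNq.
  move=> w; rewrite /leaves_below below andb_orl -[_ && _]/(leaves_below i w) -mq.
  have [wu|wu] := eqVneq w u; last by rewrite orbF; case: ifP;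
    rewrite ?mem_rcons ?inE ?(negbTE wu).
  by rewrite wu -/d; case: ifP => [_|d1];
    rewrite ?mem_rcons ?mem_head ?(negbTE uNq) ?orbT //= d1.
split=> [w|j] /=; first by rewrite !upd_queue.
(* If [u] is not a leaf, the store hit the cell just past the queue. *)
have [d1|_] := eqVneq d 1; last first.
  by move=> lt_j; rewrite upd_neq ?queue // => /addnI ej; rewrite ej ltnn in lt_j.
rewrite size_rcons ltnS map_rcons nth_rcons size_map leq_eqVlt => /predU1P[->|lt_j].
  by rewrite /upd eqxx ltnn eqxx.
by rewrite lt_j upd_neq ?queue // => /addnI ej; rewrite ej ltnn in lt_j.
Qed.

(** * The deletion loop *)

(** The number of remaining vertices is the variant, and the head of the queue counts the deleted
    ones. The lower bound [c] is carried along because the branching vertex that proves it may lose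
    its third neighbour later. *)
Definition stripping k st :=
  exists (R : {set T}) (pi : T -> T) (dl lev : T -> nat) (q : seq T) (c : nat),
   [/\ peeling R pi dl lev q c /\ (0 < c -> svs_at_least T c),
    k = #|R| /\ c + #|R| <= n, layout st,
    [/\ regs st 2 = n - #|R| + size q, regs st 3 = n - #|R|,
        regs st 8 = #|branching R| & regs st 9 = c]
    & [/\ (forall u, u \in R -> mem st (4 * n + nm u) = deg R u),
          (forall u, u \in R -> mem st (5 * n + nm u) = nsum R nm u),
          (forall u, u \in q -> mem st (6 * n + nm u) = lev u)
        & (forall j, j < size q -> mem st (7 * n + (n - #|R| + j)) = nth 0 (map nm q) j)]].

Lemma scanning_stop k st : scanning k st -> den st scan_test = 0 -> stripping n st.
Proof.
case=> i [q [ik lay [r1 r2 r3 r8 r9] [uq mq] [arr queue]]].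
have [h0 _ _ _ _] := lay; rewrite /= h0 r1 => /eqP; rewrite subn_eq0 => le_n.
have below u : nm u < i by exact: leq_trans (nm_lt u) le_n.
exists setT, id, (fun=> 0), (fun=> 0), q, 0; rewrite cardsT card_T subnn add0n;
  split=> //.
- split=> //; apply: peeling_init => // u; by rewrite mq /leaves_below below.
- split=> //; rewrite r8; congr #|pred_of_set _|; apply/setP => u.
  by rewrite !inE below.
- by split=> // u _; have [] := arr u.
Qed.

Lemma stripping_safe k st : stripping k st -> safe W st peel_test.
Proof.
case=> R [pi [dl [lev [q [c [_ _ _ [_ _ r8 _] _]]]]]] /=; rewrite r8; apply: W_lin.
by apply: leq_trans (max_card _) _; rewrite card_T; clear; lia.
Qed.

Lemma stripping_step k st : stripping k st -> den st peel_test != 0 ->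
  0 < k /\ run W peel_body (cost peel_body) st (stripping k.-1).
Proof.
case=> R [pi [dl [lev [q [c [[peel low] [-> cR] [h0 h4 h5 h6 h7] [r2 r3 r8 r9] [aD aS aL aQ]]]]]]].
rewrite /= r8 -lt0n => /card_gt0P[z zB].
have [u uR du] := branching_leaf acycT zB.
have szq := uniq_size (peel_uniq peel).
have qR : size q <= #|R|.
  rewrite -(card_uniqP (peel_uniq peel)); apply/subset_leq_card/subsetP => w.
  by rewrite (peel_leaf peel) => /andP[].
have mq := peel_leaf peel.
case: q peel aL aQ szq qR r2 mq => [|v q] peel aL aQ szq qR r2 mq.
  by have := mq u; rewrite uR du.
have /andP[vR /eqP dv] : (v \in R) && (deg R v == 1) by rewrite -mq mem_head.
have /deg_gt0P[p pR vp] : 0 < deg R v by rewrite dv.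
have zR3 : exists2 z, z \in R & 2 < deg R z by exists z; move: zB; rewrite inE => /andP[].
have peel' := peeling_step conT peel pR vp zR3.
(* The lower bound for the next state is taken before the deletion, while [z] still has three
   neighbours in [R]. *)
have low' := peeling_svs conT acycT peel zB.
have cardR : #|R| = #|R :\ v|.+1 by rewrite (cardsD1 v) vR.
have cB := branching_remove vR dv pR vp.
have levv := peel_lev peel (mem_head _ _).
have bR : #|branching R| <= n by rewrite -card_T max_card.
have pv : p != v by apply: contraTneq vp => ->; rewrite sedge_irrefl.
have degS w : w \in R -> deg R w = (w == p) + deg (R :\ v) w.
  by move=> wR; rewrite /deg (deg_remove vR dv pR vp wR) muln1.
have sumS w : w \in R -> nsum R nm w = (w == p) * nm v + nsum (R :\ v) nm w.
  by move=> wR; rewrite (deg_remove vR dv pR vp wR).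
have dR' := deg_le (R :\ v) p; have sR := nsum_le R p.
have Dp := aD p pR; have Sp := aS p pR; rewrite degS // eqxx in Dp.
rewrite sumS // eqxx mul1n in Sp sR.
have Sv : mem st (5 * n + nm v) = nm p by rewrite aS // (nsum_leaf _ pR vp dv).
have Lv := aL v (mem_head _ _).
have Qv : mem st (7 * n + (n - #|R|)) = nm v by have := aQ 0 isT; rewrite addn0.
set h := n - #|R| in r2 r3 Qv aQ; rewrite /= in r2.
set R' := R :\ v in peel' cardR cB degS sumS dR' Dp Sp sR;
  set d := deg R' p in peel' cB dR' Dp.
set b := #|branching R'| in cB.
have lv := nm_lt v; have lp := nm_lt p.
(* [lev v] is at most [c], and [c + #|R|] is at most [n] with [R] nonempty; a deletion raises [c] by
   at most one. *)
have lev_n : lev v < n by clear -levv cR cardR; case: levv; lia.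
have hq : h + (size q).+1 <= n by clear -qR cR; rewrite /h /= in qR *; lia.
split; first by rewrite cardR.
apply: run_block; apply: (@run_assign _ _ _ (nm v)); rewrite /= ?h7 ?r3 ?Qv //.
  by repeat split; apply: W_lin; clear -hq lv; lia.
apply: run_block; apply: (@run_assign _ _ _ h.+1); regs; rewrite ?r3 ?addn1 //.
  by repeat split; apply: W_lin; clear -hq; lia.
apply: run_block; apply: (@run_assign _ _ _ (lev v).+1); regs; rewrite ?h6 ?Lv ?addn1 //.
  by repeat split; apply: W_lin; clear -lev_n lv; lia.
apply: run_block; apply: (@run_assign _ _ _ (nm p)); regs; rewrite ?h5 ?Sv //.
  by repeat split; apply: W_lin; clear -lv lp; lia.
apply: run_block; apply: (@run_store _ _ _ (5 * n + nm p) (nsum R' nm p)); regs;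
  rewrite ?h5 ?Sp ?addKn //.
- by repeat split; apply: W_lin; clear -lp; lia.
- by repeat split; first [apply: W_lin; clear -lp lv; lia | apply: W_sq; clear -sR; lia].
apply: run_block; apply: (@run_assign _ _ _ d); regs; rewrite ?h4 ?upd_cell /= ?Dp.
- by repeat split; apply: W_lin; clear -lp dR'; lia.
- by clear; lia.
apply: run_block; apply: (@run_store _ _ _ (4 * n + nm p) d); regs; rewrite ?h4 //.
- by repeat split; apply: W_lin; clear -lp; lia.
- by apply: W_lin; clear -dR'; lia.
apply: run_block; apply: (@run_assign _ _ _ b); regs; rewrite ?r8 ?cB.
- by repeat split; apply: W_lin; clear -bR cB dR'; lia.
- by clear; lia.
apply: run_block; apply: (@run_store _ _ _ (7 * n + (h + (size q).+1)) (nm p)); regs;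
  rewrite ?h7 ?r2 //.
- by repeat split; apply: W_lin; clear -hq; lia.
- by apply: W_lin; clear -lp; lia.
apply: run_block; apply: (@run_store _ _ _ (6 * n + nm p) (lev v).+1); regs;
  rewrite ?h6 //.
- by repeat split; apply: W_lin; clear -lp; lia.
- by apply: W_lin; clear -lev_n; lia.
apply: run_block; apply: (@run_assign _ _ _ (h + (size q).+1 + (d == 1))); regs;
  rewrite ?r2.
- by repeat split; apply: W_lin; clear -hq dR'; lia.
- by clear; lia.
apply: run_skip.
have h' : n - #|R'| = h.+1 by rewrite /h cardR; clear -cR cardR; lia.
do 6!eexists; split; [by split; [exact: peel'|]| | | |].
- by split; [rewrite cardR|clear -levv cR cardR; case: levv; lia].
- by [].
- by split; regs => //; rewrite h' size_cat -/R' -/d; case: eqP; rewrite /=; clear; lia.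
rewrite h'; split=> [w wR'|w wR'|w|j].
- have /setD1P[wv wR] := wR'; rewrite /= !(upd_cell, upd_queue) //=.
  have [->//|wp] := eqVneq w p; by rewrite aD // degS // (negbTE wp).
- have /setD1P[wv wR] := wR'; rewrite /= !(upd_cell, upd_queue) //=.
  have [->//|wp] := eqVneq w p; by rewrite aS // sumS // (negbTE wp).
- rewrite mem_cat => wq; rewrite /= !(upd_cell, upd_queue) //=.
  have [//|wp] := eqVneq w p; apply: aL; rewrite inE.
  case/orP: wq => [->|]; first by rewrite orbT.
  by case: ifP => // _; rewrite inE (negbTE wp).
rewrite size_cat => lt_j; rewrite /= upd_cell_queue //.
have [ej|jq] := eqVneq j (size q).
  rewrite ej addSnnS /upd eqxx map_cat nth_cat size_map ltnn subnn.
  by move: lt_j; rewrite ej; case: ifP => //=; rewrite addn0 ltnn.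
have lt_jq : j < size q.
  by rewrite ltn_neqAle jq; move: lt_j; case: ifP => _ /=; clear; lia.
rewrite upd_neq; last by move/addnI; clear -lt_jq; lia.
rewrite !upd_cell_queue // addSnnS (aQ j.+1) //= map_cat nth_cat size_map lt_jq //.
Qed.

Lemma stripping_stop k st : stripping k st -> den st peel_test = 0 ->
  is_svs T (regs st 9 + ((1 - regs st 9) - (1 - (n - 1)))) /\ regs st 9 <= n.
Proof.
case=> R [pi [dl [lev [q [c [[peel low] [_ cR] _ [_ _ r8 r9] _]]]]]] /=.
rewrite r8 r9 => /eqP; rewrite cards_eq0 => /eqP B0.
have c_n : c <= n by clear -cR; lia.
split=> //; suff [lowS upS] : svs_at_least T (c + ((1 - c) - (1 - (n - 1)))) /\
    forall m (f g : path_graph m.+1 -> T), surj_weak_hom f -> surj_weak_hom g ->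
      min_dist f g <= c + ((1 - c) - (1 - (n - 1))).
  split=> //; case: lowS => m [f [g [sf sg le_k]]]; exists m, f, g; split=> //.
  by apply/eqP; rewrite eqn_leq upS.
(* For positive [c] both bounds are [c]; for [c = 0] they are 0 on a single vertex and 1
   otherwise. *)
have [c0|c_gt0] := posnP c; last first.
  have -> : c + ((1 - c) - (1 - (n - 1))) = c by clear -c_gt0; lia.
  split; first exact: low.
  by move=> m f g sf sg; have := peeling_upper conT acycT peel B0 sf sg;
    rewrite (maxn_idPl c_gt0).
have [n1|n_gt1] := leqP n 1.
  have -> : c + ((1 - c) - (1 - (n - 1))) = 0 by clear -c0 n1; lia.
  have all_eq (x y : T) : x = y.
    by apply: fintype_le1P; rewrite card_T.
  split=> [|m f g _ _]; last first.
    by apply: leq_trans (min_dist_leq f g ord0) _;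
      rewrite (all_eq (f _) (g ord0)) gdist_refl.
  have /card_gt0P[x _] : 0 < #|T| by rewrite card_T.
  by apply: (@svs_at_least_connect _ _ (x, x)) => // y; exists (x, x);
    rewrite ?(all_eq y x).
have -> : c + ((1 - c) - (1 - (n - 1))) = 1 by clear -c0 n_gt1; lia.
split; first by apply: svs_at_least1; [exact: (proj1 treeT)|rewrite card_T].
by move=> m f g sf sg; have := peeling_upper conT acycT peel B0 sf sg; rewrite c0.
Qed.


Lemma svs_cmd_run :
  run W svs_cmd (500 * n) (State (upd (fun=> 0) 0 n) input)
    (fun st => is_svs T (output st)).
Proof.
suff [N [t [st [ex le_t Qst]]] le_N] : exists2 N,
    run W svs_cmd N (State (upd (fun=> 0) 0 n) input)
      (fun st => is_svs T (output st)) & N <= 500 * n.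
  by exists t, st; split=> //; exact: leq_trans le_t le_N.
(* The time bound is left open and assembled by the rules: the loops run at most [size s], [n] and
   [n] times. *)
eexists.
  apply: run_seq; apply: (@run_assign _ _ _ (4 * n)); regs; [|lia|].
    by repeat split; apply: W_lin; clear; lia.
  apply: run_seq; apply: (@run_assign _ _ _ (5 * n)); regs; [|lia|].
    by repeat split; apply: W_lin; clear; lia.
  apply: run_seq; apply: (@run_assign _ _ _ (6 * n)); regs; [|lia|].
    by repeat split; apply: W_lin; clear; lia.
  apply: run_seq; apply: (@run_assign _ _ _ (7 * n)); regs; [|lia|].
    by repeat split; apply: W_lin; clear; lia.
  apply: run_seq; apply: (run_while reading_safe _ reading_step (k := size s));
    last first.
    exists [::], s; split=> //; split=> // u; rewrite /incidence !big_nil.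
    have sz : size (flatten [seq [:: nm uv.1; nm uv.2] | uv <- s]) = 2 * size s.
      by elim: (s) => //= a r ->; rewrite mulnS.
    by split; rewrite /= /input nth_default // sz; have := size_edges; clear; lia.
  move=> k1 st1 rd1 /(reading_stop rd1) sc1.
  apply: run_seq; apply: (@run_assign _ _ _ 0) => //=; first exact: W_lin.
  apply: run_seq; apply: (run_while scanning_safe _ scanning_step sc1).
  move=> k2 st2 sc2 /(scanning_stop sc2) sp2.
  apply: run_seq; apply: (run_while stripping_safe _ stripping_step sp2).
  move=> k3 st3 sp3 /(stripping_stop sp3)[svs3 le9].
  have r0 : regs st3 0 = n by case: sp3 => ? [? [? [? [? [? [_ _ []]]]]]].
  apply: run_seq; apply: run_assign => /=; [|by []|].
    by rewrite r0; repeat split; apply: W_lin; clear -le9; lia.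
  by apply: run_skip; rewrite /output /= r0.
(* The constant 500 is generous; [n > 0] lets it absorb the cost outside the loops. *)
have := size_edges; rewrite /cost /=; clear -n_gt0; lia.
Qed.

End Program.

Theorem theorem3p6 :
  exists (A : cmd) (w c : nat),
    forall (T : sgraph) (num : T -> 'I_#|T|) (s : seq (T * T)),
      is_tree T -> injective num -> edge_list s ->
      exists (t : nat) (st : state),
        [/\ exec (#|T|.+1 ^ w) (input_state num s) A t st,
            t <= c * #|T|
          & is_svs T (output st)].
Proof.
(* The fifth power is needed for n = 1, where the word bound must exceed 1 + 8 + 8 = 17 and 2 to the
   fourth is only 16. *)
exists svs_cmd, 5, 500 => T num s treeT num_inj edges_s.
have n_gt0 : 0 < #|T| by have [[]] := treeT.
have [num' _ numK] : bijective num by apply: inj_card_bij; rewrite ?card_ord.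
apply: (@svs_cmd_run T #|T| _ (fun u => val (num u))) => //.
- by move=> u; exact: ltn_ord.
- by move=> u v /val_inj/num_inj.
- by move=> i lt_i; exists (num' (Ordinal lt_i)); rewrite numK.
move: (#|T|) n_gt0 => n n_gt0; rewrite !expnS expn0; nia.
Qed.
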